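(* Suppose that the extension $F/\mathbb{Q}_p$ is ramified (i.e. $e\ge2$), and let $\chi$ be a character of $B(\mathcal{O}/\mathfrak{m}^2)$. For every type $(I,\gamma)$, the subspace $V_{(I,\gamma)}$ of $I_2(\chi)$ is stable under the action of $\mathrm{GL}_2(\mathcal{O}/\mathfrak{m}^2)$. Moreover, $V_{(I,\gamma)}$ is generated, as a $\mathrm{GL}_2(\mathcal{O}/\mathfrak{m}^2)$-submodule of $I_2(\chi)$, by any element of $\mathcal{B}$ of type $(I,\gamma)$.
   Context: Let $p$ be an odd prime, $F/\mathbb{Q}_p$ a finite extension with valuation ring $\mathcal{O}$, maximal ideal $\mathfrak{m}$, uniformizer $\varpi$, ramification index $e$, and residue field $k$ of cardinality $q=p^f$. All representations are over an extension field $E$ of $k$. $B\le\mathrm{GL}_2$ is the upper triangular subgroup. Every $\lambda\in\mathcal{O}/\mathfrak{m}^2$ is written uniquely as $\lambda=[\lambda_0]+[\lambda_1]\varpi$ with $\lambda_i\in k$, $[\cdot]$ being the Teichmüller lift. Monoid. $\widetilde{\mathbb{N}}$ is the quotient monoid of $(\mathbb{N}\cup\{0\},+)$ by: $a\sim b$ iff $a=b=0$, or $a,b>0$ and $a\equiv b \bmod q-1$ (so $x^\alpha$ makes sense for $x\in k$, $\alpha\in\widetilde{\mathbb{N}}$, with $0^0=1$). Each $\alpha\in\widetilde{\mathbb{N}}$ contains a unique integer $\sum_{i=0}^{f-1}\alpha_ip^i$ with digits $0\le\alpha_i\le p-1$; indices $i$ are viewed in $\mathbb{Z}/f\mathbb{Z}$.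 $\widetilde{\mathbb{N}}\setminus\{0\}$ is identified with $\mathbb{Z}/(q-1)\mathbb{Z}$. Write $\alpha\preceq\beta$ iff $\alpha_i\le\beta_i$ for all $i$; then $\beta\ominus\alpha$ is the element with digits $\beta_i-\alpha_i$. For $a\ne0$, $a-b$ is the unique $c\in\widetilde{\mathbb{N}}\setminus\{0\}$ with $b+c=a$. Carry sets. For $\alpha,\beta\in\widetilde{\mathbb{N}}$, $I(\alpha,\beta)\subseteq\mathbb{Z}/f\mathbb{Z}$ is the unique subset such that for all $i$: $\alpha_i+\beta_i\le p-1$ if $i-1,i\notin I(\alpha,\beta)$; $\alpha_i+\beta_i\le p-2$ if $i-1\in I(\alpha,\beta)$, $i\notin I(\alpha,\beta)$; $\alpha_i+\beta_i\ge p$ if $i-1\notin I(\alpha,\beta)$, $i\in I(\alpha,\beta)$; $\alpha_i+\beta_i\ge p-1$ if $i-1,i\in I(\alpha,\beta)$; and $I(\alpha,\beta)=\varnothing$ if $\alpha_i+\beta_i=p-1$ for all $i$. Representation and basis. Every character $\chi$ of $B(\mathcal{O}/\mathfrak{m}^2)$ factors through $B(k)$ and is uniquely $\chi=\det^s\cdot\chi_r$ with $s,r\in\mathbb{Z}/(q-1)\mathbb{Z}$, where $\det$ is followed by reduction to $k^\times$ and $\chi_r\begin{pmatrix}a&b\\0&d\end{pmatrix}=(d\bmod\mathfrak{m})^r$; view $r\in\widetilde{\mathbb{N}}\setminus\{0\}$. $I_2(\chi)=\mathrm{Ind}_{B(\mathcal{O}/\mathfrak{m}^2)}^{\mathrm{GL}_2(\mathcal{O}/\mathfrak{m}^2)}\chi$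 is the space of functions $\varphi$ with $\varphi(bg)=\chi(b)\varphi(g)$, under right translation; it is identified with $\det^s\otimes I_2(\chi_r)$ via $\det(g)^s\varphi(g)\leftrightarrow\varphi(g)$. In $I_2(\chi_r)$, $g\otimes v$ is the function supported on $B(\mathcal{O}/\mathfrak{m}^2)g^{-1}$ with value $\chi_r(b)v$ at $bg^{-1}$. For $(j_0,j_1)\in\widetilde{\mathbb{N}}^2$ put $f_{(j_0,j_1)}=\sum_{\lambda\in\mathcal{O}/\mathfrak{m}^2}\begin{pmatrix}\lambda&1\\1&0\end{pmatrix}\otimes\lambda_0^{j_0}\lambda_1^{j_1}$, and $f_{(\infty,j_1)}=w f_{(0,j_1)}$ with $w=\begin{pmatrix}0&1\\1&0\end{pmatrix}$ acting on $I_2(\chi_r)$. With $\Theta=(\widetilde{\mathbb{N}}\cup\{\infty\})\times\widetilde{\mathbb{N}}$, the set $\mathcal{B}=\{f_{(j_0,j_1)}:(j_0,j_1)\in\Theta\}$ is a basis of $I_2(\chi_r)$, hence of $I_2(\chi)$. Types. Let $\le_r$ be the smallest preorder on $\Theta$ such that, for $m\in\{0,\dots,f-1\}$ and $j_1\in\widetilde{\mathbb{N}}$: (1) $(j_0\ominus p^m,j_1)\le_r(j_0,j_1)$ if $j_0\in\widetilde{\mathbb{N}}$, $p^m\preceq j_0$; (2) $(j_0,j_1\ominus p^m)\le_r(j_0,j_1)$ if $j_0\in\widetilde{\mathbb{N}}$, $p^m\preceq j_1$; (3) $(j_0+p^m,j_1\ominus p^m)\le_r(j_0,j_1)$ if $j_0\in\widetilde{\mathbb{N}}$,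 $p^m\preceq j_1$; (4) $(r-2j_1-j_0,j_1)\le_r(j_0,j_1)$ if $j_0\notin\{0,\infty\}$; (5) $(r-2j_1,j_1\ominus p^m)\le_r(\infty,j_1)$ if $p^m\preceq j_1$; (6) $((r-2j_1)\ominus p^m,j_1)\le_r(\infty,j_1)$ if $p^m\preceq r-2j_1$; (7) $(0,j_1)\le_r(\infty,j_1)$ and $(\infty,j_1)\le_r(0,j_1)$. Two elements are equivalent if each is $\le_r$ the other. A type is an equivalence class; $\le_r$ induces a partial order on types, denoted $\le_\chi$. The class of $(j_0,j_1)$ is encoded by the pair $(I(j_0',r-2j_1-j_0'),j_1)\in\mathcal{P}(\mathbb{Z}/f\mathbb{Z})\times\widetilde{\mathbb{N}}$ for any representative $(j_0',j_1)$ with $j_0'\in\widetilde{\mathbb{N}}$; this encoding is well defined and injective, and types are written as such pairs $(I,\gamma)$. The type of $f_{(j_0,j_1)}$ is the type of $(j_0,j_1)$. $V_{(I,\gamma)}\subseteq I_2(\chi)$ is the span of the elements of $\mathcal{B}$ whose type is $\le_\chi(I,\gamma)$. *)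

(* Defs.v *)
From HB Require Import structures.
From mathcomp Require Import all_boot all_order all_algebra all_fingroup all_field.

Set Implicit Arguments.
Unset Strict Implicit.
Unset Printing Implicit Defensive.

Import Order.TTheory GRing.Theory Num.Theory.

Local Open Scope ring_scope.

(* Normalised discrete valuations.  The valuation of 0 is +oo: the value    *)
(* [dval 0] is unconstrained and never used, see [vge].                     *)
Record discrete_valuation (F : fieldType) := DiscreteValuation {
  dval :> F -> int;
  dvalM : forall x y, x != 0 -> y != 0 -> dval (x * y) = dval x + dval y;
  dvalD : forall x y, x != 0 -> y != 0 -> x + y != 0 ->
    Num.min (dval x) (dval y) <= dval (x + y);
  dval_unif : exists2 x, x != 0 & dval x = 1
}.

Definition vge (F : fieldType) (v : discrete_valuation F) (n : int) (x : F) :=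
  (x == 0) || (n <= v x).

Definition vcauchy (F : fieldType) (v : discrete_valuation F) (u : nat -> F) :=
  forall n : int, exists N : nat,
    forall i j, (N <= i)%N -> (N <= j)%N -> vge v n (u i - u j).

Definition vconverges (F : fieldType) (v : discrete_valuation F)
    (u : nat -> F) (l : F) :=
  forall n : int, exists N : nat, forall i, (N <= i)%N -> vge v n (u i - l).

(* (K, v) is the field Q_p with its p-adic valuation, i.e. the completion   *)
(* of Q for the p-adic valuation.                                           *)
Record is_Qp (p : nat) (K : fieldType) (v : discrete_valuation K) : Prop := {
  Qp_val : forall n : nat, (0 < n)%N ->
    n%:R != 0 :> K /\ v n%:R = (logn p n)%:Z;
  Qp_dense : forall (x : K) (n : int), exists a : rat, vge v n (x - ratr a);
  Qp_complete : forall u, vcauchy v u -> exists l, vconverges v u l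
}.

(* v extends the valuation v0 of K up to the normalisation factor e; as     *)
(* both valuations are normalised, e is the ramification index.             *)
Definition ramification_index (K : fieldType) (F : fieldExtType K)
    (v0 : discrete_valuation K) (v : discrete_valuation F) (e : nat) :=
  (0 < e)%N /\ forall x : K, x != 0 -> v (x%:A) = e%:Z * v0 x.

Section ValuationRing.
Variables (F : fieldType) (v : discrete_valuation F).

Lemma dval1 : v 1 = 0.
Proof.
have /eqP := dvalM v (oner_neq0 F) (oner_neq0 F).
by rewrite mulr1 -subr_eq subrr eq_sym => /eqP.
Qed.

Lemma dvalN1 : v (-1) = 0.
Proof.
have n1 : -1 != 0 :> F by rewrite oppr_eq0 oner_eq0.
have := dvalM v n1 n1; rewrite mulrNN mulr1 dval1 => /esym/eqP.
by rewrite -mulr2n mulrn_eq0 /= => /eqP.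
Qed.

Definition valint : {pred F} := [pred x | vge v 0 x].

Lemma valint_subring : subring_closed valint.
Proof.
have valM x y : x \in valint -> y \in valint -> x * y \in valint.
  rewrite !inE /vge.
  have [->|nx] := eqVneq x 0; first by rewrite mul0r eqxx.
  have [->|ny] := eqVneq y 0; first by rewrite mulr0 eqxx.
  by move=> /= hx hy; rewrite dvalM // addr_ge0 ?orbT.
have valN1 : -1 \in valint by rewrite inE /vge dvalN1 lexx orbT.
split; [by rewrite inE /vge dval1 lexx orbT | | exact: valM].
move=> x y hx /(valM _ _ valN1); rewrite mulN1r; move: (- y) hx => {}y.
rewrite !inE /vge.
have [->|nx] := eqVneq x 0; first by rewrite add0r.
have [->|ny] := eqVneq y 0; first by rewrite addr0 (negPf nx).
have [->|nxy] := eqVneq (x + y) 0 => //= hx hy.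
by apply: (le_trans _ (dvalD v nx ny nxy)); rewrite le_min hx.
Qed.

HB.instance Definition _ := GRing.isSubringClosed.Build F valint valint_subring.

Definition valring : Type := {x : F | x \in valint}.

HB.instance Definition _ := SubChoice.on valring.
HB.instance Definition _ := [SubChoice_isSubComNzRing of valring by <:].

Definition maxideal (x : valring) : Prop := vge v 1 (val x).

Definition uniformizer (x : valring) : Prop := val x != 0 /\ v (val x) = 1.

End ValuationRing.

Definition ideal_mul (R : pzRingType) (I J : R -> Prop) (x : R) : Prop :=
  exists s : seq (R * R),
    (forall ab, ab \in s -> I ab.1 /\ J ab.2) /\
    x = \sum_(ab <- s) ab.1 * ab.2.

(* h exhibits S as the quotient ring R / I. *)
Definition is_quotient (R S : pzRingType) (I : R -> Prop)
    (h : {rmorphism R -> S}) : Prop :=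
  (forall y, exists x, h x = y) /\ (forall x, h x = 0 <-> I x).

(* The Teichmueller lift is the unique multiplicative section of the        *)
(* reduction map.                                                           *)
Definition is_teichmuller (R k : pzRingType) (red : {rmorphism R -> k})
    (t : k -> R) : Prop :=
  (forall x y, t (x * y) = t x * t y) /\ (forall x, red (t x) = x).

(* The congruence on N whose quotient is N~, for q = p ^ f. *)
Definition nt_cong (q a b : nat) : bool :=
  (a == 0)%N && (b == 0)%N || [&& (0 < a)%N, (0 < b)%N & a == b %[mod q.-1]].

(* Each class contains exactly one integer in [0, q - 1]; [Ntilde] is the   *)
(* set of these representatives, [nt_class] maps an integer to its class,   *)
(* and [nt_classP], [nrepK] identify [Ntilde] with the quotient of N.       *)
(* (The additive structure below is not the one of 'I_q.)                   *)
Section Ntilde.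
Variables p f : nat.
Local Notation q := (p ^ f)%N.

Definition Ntilde : Type := 'I_(q.-1.+1).
HB.instance Definition _ := Finite.on Ntilde.

Definition nrep (a : Ntilde) : nat := nat_of_ord a.

Definition nt_class (n : nat) : Ntilde :=
  if n is n'.+1 then inord (n' %% q.-1).+1 else ord0.

Lemma nrep_class n : (1 < q)%N ->
  nrep (nt_class n) = if n is n'.+1 then (n' %% q.-1).+1 else 0%N.
Proof.
move=> q1; rewrite /nrep; case: n => [|n] //=; rewrite inordK //.
by rewrite ltnS ltn_mod -ltnS prednK // ltnW.
Qed.

Lemma nrepK : (1 < q)%N -> cancel nrep nt_class.
Proof.
move=> q1 a; apply: val_inj; change (nrep (nt_class (nrep a)) = nrep a).
rewrite nrep_class // /nrep; case: a => [[|a] ha] //=.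
by rewrite modn_small // -ltnS.
Qed.

Lemma nt_classP a b : (1 < q)%N ->
  (nt_class a == nt_class b) = nt_cong q a b.
Proof.
move=> q1; rewrite -val_eqE; change
  ((nrep (nt_class a) == nrep (nt_class b)) = nt_cong q a b).
rewrite !nrep_class // /nt_cong; case: a b => [|a] [|b] //=.
by rewrite eqSS -(eqn_modDr 1) !addn1.
Qed.

Definition nt_add (a b : Ntilde) : Ntilde := nt_class (nrep a + nrep b).

Lemma nt_classD a b : (1 < q)%N ->
  nt_add (nt_class a) (nt_class b) = nt_class (a + b).
Proof.
move=> q1; apply/eqP; rewrite nt_classP // !nrep_class // /nt_cong.
have E c : ((c %% q.-1).+1 = c.+1 %[mod q.-1])%N.
  by rewrite -addn1 modnDml addn1.
case: a b => [|a] [|b] //=; rewrite ?addn0 ?add0n //=.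
- by apply/eqP/E.
- by apply/eqP/E.
by apply/eqP; rewrite -modnDm !E modnDm.
Qed.

Lemma nt_addC : commutative nt_add.
Proof. by move=> a b; rewrite /nt_add addnC. Qed.

Lemma nt_triv (a b : Ntilde) : (q <= 1)%N -> a = b.
Proof.
move=> q1; apply: val_inj; case: a b => [a ha] [b hb] /=.
have q0 : q.-1 = 0%N by case: q q1 => [|[]].
by move: ha hb; rewrite q0 !ltnS !leqn0 => /eqP -> /eqP ->.
Qed.

Lemma nt_addA : associative nt_add.
Proof.
have [q1|/nt_triv tr] := ltnP 1 q; last by move=> *; apply: tr.
move=> a b c; rewrite -(nrepK q1 a) -(nrepK q1 b) -(nrepK q1 c).
by rewrite !nt_classD // addnA.
Qed.

Lemma nt_add0 : left_id (nt_class 0) nt_add.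
Proof.
have [q1|/nt_triv tr] := ltnP 1 q; last by move=> *; apply: tr.
by move=> a; rewrite -[a in LHS](nrepK q1) nt_classD // add0n nrepK.
Qed.

HB.instance Definition _ := GRing.isNmodule.Build Ntilde nt_addA nt_addC nt_add0.

(* The subtraction a - b, meaningful for a != 0; see [nt_subP]. *)
Definition nt_sub (a b : Ntilde) : Ntilde := nt_class (nrep a + q.-1 - nrep b).

Lemma nt_subP (a b c : Ntilde) : (1 < q)%N -> a != 0 ->
  (nt_sub a b == c) = (c != 0) && (b + c == a).
Proof.
move=> q1 a0; have nt0 : (0 : Ntilde) = nt_class 0 by [].
have posE (x : Ntilde) : (x != 0) = (0 < nrep x)%N.
  by rewrite -{1}(nrepK q1 x) nt0 nt_classP // /nt_cong ltnn andbF /= andbT orbF lt0n.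
have bq : (nrep b <= q.-1)%N by rewrite /nrep -ltnS.
have a1 : (0 < nrep a)%N by rewrite -posE.
have -> : (nt_sub a b == c) = nt_cong q (nrep a + q.-1 - nrep b) (nrep c).
  by rewrite -[c in LHS](nrepK q1) nt_classP.
have -> : (b + c == a) = nt_cong q (nrep b + nrep c) (nrep a).
  by rewrite -[a in LHS](nrepK q1) nt_classP.
rewrite posE /nt_cong.
have s1 : (0 < nrep a + q.-1 - nrep b)%N
  by rewrite subn_gt0 (leq_ltn_trans bq) // -[X in (X < _)%N]add0n ltn_add2r.
rewrite s1 a1 (gtn_eqF s1) (gtn_eqF a1) andbF /=.
case: (posnP (nrep c)) => [-> //|c1] /=.
rewrite addn_gt0 c1 orbT /= -(eqn_modDl (nrep b)) subnKC; last first.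
  by rewrite (leq_trans bq) ?leq_addl.
by rewrite modnDr eq_sym.
Qed.

Definition digit (a : Ntilde) (i : 'I_f) : nat := (nrep a %/ p ^ i) %% p.

Definition nt_preceq (a b : Ntilde) : bool :=
  [forall i, (digit a i <= digit b i)%N].

(* Meaningful when [nt_preceq a b]. *)
Definition nt_ominus (b a : Ntilde) : Ntilde :=
  nt_class (\sum_(i < f) (digit b i - digit a i) * p ^ i).

Definition nt_pow (m : 'I_f) : Ntilde := nt_class (p ^ m).

(* I is the carry set I(a, b). Here [ord_pred i] is i - 1 in Z/fZ. *)
Definition is_carry_set (a b : Ntilde) (I : {set 'I_f}) : bool :=
  [forall i,
    let d := (digit a i + digit b i)%N in
    match ord_pred i \in I, i \in I with
    | false, false => d <= p - 1
    | true, false => d <= p - 2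
    | false, true => p <= d
    | true, true => p - 1 <= d
    end%N]
  && ([forall i, digit a i + digit b i == p - 1]%N ==> (I == set0)).

(* [None] stands for the index oo. *)
Definition Theta : Type := (option Ntilde * Ntilde)%type.

Variable r : Ntilde.

Definition rsub2 (j1 : Ntilde) : Ntilde := nt_sub r (j1 *+ 2).

(* [below x y] is the union of the generating relations x <=_r y; [le_r] is  *)
(* the smallest preorder containing it.                                      *)
Definition below (x y : Theta) : bool :=
  match y with
  | (Some j0, j1) =>
    [|| [exists m, nt_preceq (nt_pow m) j0 &&
                   (x == (Some (nt_ominus j0 (nt_pow m)), j1))],
        [exists m, nt_preceq (nt_pow m) j1 &&
                   (x == (Some j0, nt_ominus j1 (nt_pow m)))],
        [exists m, nt_preceq (nt_pow m) j1 &&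
                   (x == (Some (j0 + nt_pow m), nt_ominus j1 (nt_pow m)))],
        (j0 != 0) && (x == (Some (nt_sub (rsub2 j1) j0), j1))
      | (j0 == 0) && (x == (None, j1))]
  | (None, j1) =>
    [|| [exists m, nt_preceq (nt_pow m) j1 &&
                   (x == (Some (rsub2 j1), nt_ominus j1 (nt_pow m)))],
        [exists m, nt_preceq (nt_pow m) (rsub2 j1) &&
                   (x == (Some (nt_ominus (rsub2 j1) (nt_pow m)), j1))]
      | x == (Some 0, j1)]
  end.

Definition le_r (x y : Theta) : bool := connect below x y.

Definition type_of (x : Theta) : {set Theta} :=
  [set y | le_r x y && le_r y x].

Definition is_type (T : {set Theta}) : Prop := exists x, T = type_of x.

Definition le_type (T T' : {set Theta}) : bool :=
  [exists x in T, [exists y in T', le_r x y]].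

(* (I, g) is the code of the type T. *)
Definition encodes (I : {set 'I_f}) (g : Ntilde) (T : {set Theta}) : Prop :=
  exists2 j0, (Some j0, g) \in T & is_carry_set j0 (nt_sub (rsub2 g) j0) I.

End Ntilde.

(* A stands for O / m^2, [rho] for the reduction A -> k,                    *)
(* [t] for the Teichmueller lift k -> A, [pi] for the image in A of the     *)
(* uniformizer, and E is an extension of k through [iota].                  *)

Section PrincipalSeries.
Variables (p f : nat) (A : finComUnitRingType) (k : finFieldType).
Variables (rho : {rmorphism A -> k}) (t : k -> A) (pi : A).
Variables (E : fieldType) (iota : {rmorphism k -> E}).

Local Notation G := {'GL_2[A]}.
Local Notation Nt := (Ntilde p f).

Definition gl_mx (g : G) : 'M[A]_2 := GLval g.

Definition borel : {set G} := [set g | gl_mx g 1 0 == 0].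

Definition mx2 (a b c d : A) : 'M[A]_2 :=
  \matrix_(i, j) if i == 0 then if j == 0 then a else b
                 else if j == 0 then c else d.

Lemma det_mx2 a b c d : \det (mx2 a b c d) = a * d - b * c.
Proof.
rewrite (expand_det_row _ 0) !big_ord_recl big_ord0 /cofactor !det_mx11 !mxE /=.
by rewrite addr0 expr0 expr1 mul1r mulN1r mulrN.
Qed.

Lemma mx2_lam_unit a : mx2 a 1 1 0 \is a GRing.unit.
Proof. by rewrite -[_ \is a _]/(_ \in unitmx) unitmxE det_mx2 mulr0 mulr1 sub0r unitrN1. Qed.

(* The matrix (a 1; 1 0); for a = 0 it is the matrix w. *)
Definition lam_mx (a : A) : G := FinRing.unit _ (mx2_lam_unit a).

Definition is_character (chi : G -> E) : Prop :=
  {in borel, forall b, chi b != 0} /\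
  {in borel &, forall b b', chi (b * b')%g = chi b * chi b'}.

Definition kpow (R : pzSemiRingType) (x : R) (a : Nt) : R := x ^+ nrep a.

Definition detpow (s : Nt) (g : G) : E := iota (kpow (rho (\det (gl_mx g))) s).

Definition chi_ (r : Nt) (b : G) : E := iota (kpow (rho (gl_mx b 1 1)) r).

Local Notation fun_G := {ffun G -> E^o}.

Definition gl_act (g : G) (phi : fun_G) : fun_G := [ffun x => phi (x * g)%g].

Definition induced (chi : G -> E) : {pred fun_G} :=
  [pred phi : fun_G |
    [forall b in borel, forall g, phi (b * g)%g == chi b * phi g]].

(* g (x) c in I_2(chi_r), supported on B g^-1 *)
Definition tens (r : Nt) (g : G) (c : E) : fun_G :=
  [ffun x => if (x * g)%g \in borel then chi_ r (x * g)%g * c else 0].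

(* The pair (l0, l1) such that l = [l0] + [l1] pi *)
Definition teich_coord (l : A) : k * k :=
  odflt (0, 0) [pick c : k * k | l == t c.1 + t c.2 * pi].

Definition fbasis_r (r : Nt) (x : Theta p f) : fun_G :=
  let f_ j0 j1 : fun_G := \sum_(l : A)
    tens r (lam_mx l)
      (iota (kpow (teich_coord l).1 j0 * kpow (teich_coord l).2 j1)) in
  match x with
  | (Some j0, j1) => f_ j0 j1
  | (None, j1) => gl_act (lam_mx 0) (f_ 0 j1)
  end.

(* The same basis transported to I_2(det^s chi_r) = det^s (x) I_2(chi_r) *)
Definition fbasis (s r : Nt) (x : Theta p f) : fun_G :=
  [ffun g => detpow s g * fbasis_r r x g].

Definition Vtype (s r : Nt) (T : {set Theta p f}) : {vspace fun_G} :=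
  <<[seq fbasis s r x | x in [set x | le_type r (type_of r x) T]]>>%VS.

Definition gl_stable (V : {vspace fun_G}) : Prop :=
  forall g phi, phi \in V -> gl_act g phi \in V.

Definition gl_generated (phi : fun_G) : {vspace fun_G} :=
  <<[seq gl_act g phi | g : G]>>%VS.

End PrincipalSeries.

(* Main.v *)
Require Import Defs.
From HB Require Import structures.
From mathcomp Require Import all_boot all_order all_algebra all_fingroup all_field.
From mathcomp Require Import ring zify.
Set Implicit Arguments.
Unset Strict Implicit.
Unset Printing Implicit Defensive.

Import Order.TTheory GRing.Theory Num.Theory.

Local Open Scope ring_scope.

(** The ramification makes [p = 0] in [A = O / m^2], so the Teichmueller lift
    is additive and [A] is the ring [k + k * pi] of dual numbers
    ([teichmuller_dual]).  Write [(c, d)] for the bottom row of a matrix, [x]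
    and [y] for the reductions of [c] and [d], and [D = x * d_1 - y * c_1],
    where [_1] denotes the coefficient of [pi].  Up to a sign, each basis
    function is a monomial [det ^ s * x ^ a * y ^ b * D ^ c]
    ([fbasis_monomial]).  The pairs [(j_0, j_1)] correspond to the exponents
    [(a, b, c)] with [a], [b] not both zero and [a + b + 2c = r], by [b = j_0]
    and [c = j_1]; the index oo stands for [a = 0].  In these terms
    [le_r] is the preorder generated by
      - the exchange of [a] and [b];
      - the replacement of [y ^ P] by [x ^ P];
      - the replacement of [D ^ P] by [x ^ (2P)] or by [(x * y) ^ P],
    where [P = p ^ m] and the [m]-th base [p] digit of the exponent of [y],
    resp. [D], is positive ([thetaP], [belowP], [le_r_xy]).

    These are the terms created by the group.  It is generated by [w], which
    exchanges [x] and [y] and negates [D], by the unipotent matrices with entry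
    [lam] or [lam * pi], which map [y] to [y + lam * x], resp. [D] to
    [D + lam * x ^ 2], and by the diagonal matrices, which scale [x] and [y]
    and map [D] to [c1 * D + c2 * x * y] ([gl2_gen]).  Splitting an exponent
    into base [p] digits and using that [p ^ m]-th powers are additive on [k],
    each of these substitutions only produces monomials that are smaller for
    [le_r] ([substitution_mem]), whence the stability ([stable_span]).
    Conversely, when a substitution depends on a parameter [lam] ranging over
    the [q] elements of [k], the result is a polynomial of degree less than [q]
    in [lam], and a Vandermonde argument shows that its coefficients lie in
    any stable subspace containing the monomial.  The coefficient of
    [lam ^ (p ^ m)] is the corresponding digit times the monomial of one of the
    relations above ([extraction_mem]).  So a stable subspace which contains a
    basis function contains all the smaller ones ([le_r_mem]). *)

(** * Base p digits *)

Section Digits.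
Variables p f : nat.
Hypothesis p_gt1 : (1 < p)%N.

Lemma digits_lt (d : 'I_f -> nat) :
  (forall i, d i < p)%N -> (\sum_(i < f) d i * p ^ i < p ^ f)%N.
Proof.
elim: f d => [|n IHn] d d_lt; first by rewrite big_ord0.
rewrite big_ord_recr /= expnS.
apply: (@leq_trans (p ^ n + d ord_max * p ^ n)).
  by rewrite ltn_add2r; apply: IHn => i.
by rewrite -mulSn leq_mul2r d_lt orbT.
Qed.

Lemma digits_mod (d : 'I_f -> nat) (m : 'I_f) : (forall i, d i < p)%N ->
  ((\sum_(i < f) d i * p ^ i) %/ p ^ m %% p = d m)%N.
Proof.
elim: f d m => [d []//|n IHn] d m d_lt.
rewrite big_ord_recl expn0 muln1.
have -> : (\sum_(i < n) d (lift ord0 i) * p ^ lift ord0 i =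
           (\sum_(i < n) d (lift ord0 i) * p ^ i) * p)%N.
  by rewrite big_distrl; apply: eq_bigr => i _; rewrite /= expnSr mulnA.
case: (unliftP ord0 m) => [j|] -> /=; last first.
  by rewrite expn0 divn1 addnC modnMDl modn_small.
have p_gt0 : (0 < p)%N by rewrite ltnW.
by rewrite expnS divnMA addnC (divnMDl _ _ p_gt0) (divn_small (d_lt _)) addn0 IHn.
Qed.

Lemma sum_digits n : (n < p ^ f)%N ->
  (\sum_(i < f) (n %/ p ^ i %% p) * p ^ i = n)%N.
Proof.
elim: f n => [|m IHm] n n_lt.
  by rewrite big_ord0; move: n_lt; rewrite expn0 ltnS leqn0 => /eqP.
rewrite big_ord_recl expn0 divn1 muln1 [RHS](divn_eq n p) addnC; congr (_ + _)%N.
rewrite -[in RHS](IHm (n %/ p)%N); last by rewrite ltn_divLR ?(ltnW p_gt1) // -expnSr.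
rewrite big_distrl; apply: eq_bigr => i _ /=.
by rewrite expnSr mulnA -divnMA [(p * _)%N]mulnC.
Qed.

End Digits.

Lemma digit_ge p n m : (0 < n %/ p ^ m %% p -> p ^ m <= n)%N.
Proof. by case: (leqP (p ^ m)%N n) => // /divn_small ->; rewrite mod0n. Qed.

(** * Exponents of monomials and the preorder *)

Section NtildeArithmetic.
Variables p f : nat.
Hypotheses (p_gt1 : (1 < p)%N) (f_gt0 : (0 < f)%N).
Local Notation q := (p ^ f)%N.
Local Notation Nt := (Ntilde p f).
Local Notation cls := (nt_class p f).
Implicit Types (a b c n : nat) (m : 'I_f).

Lemma q_gt1 : (1 < q)%N.
Proof. by rewrite -(expn0 p) ltn_exp2l. Qed.

Lemma nt_class_add a b : cls (a + b) = cls a + cls b.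
Proof. by rewrite -nt_classD ?q_gt1. Qed.

Lemma nt_class_mul2 a : cls (2 * a) = cls a *+ 2.
Proof. by rewrite mul2n -addnn nt_class_add. Qed.

Lemma nt_class_eq0 a : (cls a == 0) = (a == 0)%N.
Proof. by rewrite -[0]/(cls 0) nt_classP ?q_gt1 // /nt_cong /= andbF orbF andbT. Qed.

Lemma nrep_lt (a : Nt) : (nrep a < q)%N.
Proof. by rewrite /nrep -[X in (_ < X)%N]prednK // ltnW // q_gt1. Qed.

Lemma nrep_small n : (n < q)%N -> nrep (cls n) = n.
Proof.
move=> n_lt; rewrite nrep_class ?q_gt1 //; case: n n_lt => // n n_lt.
by rewrite modn_small //; have := q_gt1; lia.
Qed.

Lemma pow_lt m : (p ^ m < q)%N.
Proof. by rewrite ltn_exp2l. Qed.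

Lemma digit_pow m i : digit (nt_pow p m) i = (i == m).
Proof.
rewrite /digit /nt_pow nrep_small ?pow_lt //.
have <- := @digits_mod p f p_gt1 (fun i => (i == m) : nat) i _; last first.
  by move=> j /=; case: eqP => _ //; rewrite ltnW.
by rewrite (bigD1 m) //= eqxx mul1n big1 ?addn0 // => j /negPf ->.
Qed.

Lemma preceq_pow m (a : Nt) : nt_preceq (nt_pow p m) a = (0 < digit a m)%N.
Proof.
apply/forallP/idP => [/(_ m)|a_m i]; first by rewrite digit_pow eqxx.
by rewrite digit_pow; case: eqP => // ->.
Qed.

Lemma digit_class n m : (n < q)%N -> digit (cls n) m = (n %/ p ^ m %% p)%N.
Proof. by move=> n_lt; rewrite /digit nrep_small. Qed.

Lemma ominus_pow m n : (n < q)%N -> (0 < n %/ p ^ m %% p)%N ->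
  nt_ominus (cls n) (nt_pow p m) = cls (n - p ^ m).
Proof.
move=> n_lt n_m; congr (cls _).
rewrite -[in RHS](sum_digits p_gt1 n_lt) (bigD1 m) //= [in RHS](bigD1 m) //=.
rewrite digit_pow eqxx mulnBl mul1n digit_class // addnC [in RHS]addnC.
rewrite addnBA; last by rewrite leq_pmull.
congr (_ + _ - _)%N; apply: eq_bigr => i /negPf im.
by rewrite digit_pow im subn0 digit_class.
Qed.

Section Theta.
Variable r : Nt.
Hypothesis r_neq0 : r != 0.
Local Notation Th := (Theta p f).

(** The exponents for which [x ^ a * y ^ b * D ^ c] transforms by [chi_r] under
    the Borel subgroup, [x] and [y] having degree 1 and [D] degree 2, and is not
    a power of [D] alone. *)
Definition admissible a b c := (0 < a + b)%N && (cls (a + b + 2 * c) == r).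

(** For admissible exponents, the class of [a] is determined by [b] and [c] if
    [a] is positive, and that of [b] by [c] if [a = 0]. *)
Definition monomial_index a b c : Th :=
  if a == 0%N then (None, cls c) else (Some (cls b), cls c).

Local Notation adm := admissible.
Local Notation idx := monomial_index.

Lemma rsub2_admissible a b c : adm a b c -> rsub2 r (cls c) = cls (a + b).
Proof.
move=> /andP[ab /eqP rE]; apply/eqP.
rewrite nt_subP ?q_gt1 // nt_class_eq0 -lt0n ab -nt_class_mul2 -nt_class_add.
by rewrite addnC rE eqxx.
Qed.

Lemma sub_rsub2_admissible a b c : adm a b c -> (0 < a)%N ->
  nt_sub (rsub2 r (cls c)) (cls b) = cls a.
Proof.
move=> abc a0; apply/eqP; rewrite (rsub2_admissible abc).
have [ab _] := andP abc.
by rewrite nt_subP ?q_gt1 ?nt_class_eq0 -?lt0n // a0 -nt_class_add addnC eqxx.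
Qed.

Lemma admissibleC a b c : adm a b c = adm b a c.
Proof. by rewrite /adm (addnC a). Qed.

Lemma below_swap a b c : adm a b c -> below r (idx b a c) (idx a b c).
Proof.
move=> abc; have [ab _] := andP abc; rewrite /idx.
case: (posnP a) => [a0|a0]; case: (posnP b) => [b0|b0] /=.
- by move: ab; rewrite a0 b0.
- by rewrite a0 eqxx !orbT.
- by rewrite b0 eqxx !orbT.
by rewrite (sub_rsub2_admissible abc) // eqxx nt_class_eq0 -lt0n b0 !orbT.
Qed.

Lemma below_shift a b c m : adm a b c -> (b < q)%N -> (0 < b %/ p ^ m %% p)%N ->
  adm (a + p ^ m) (b - p ^ m) c /\
  below r (idx (a + p ^ m) (b - p ^ m) c) (idx a b c).
Proof.
move=> abc b_lt b_m; have b_ge := digit_ge b_m.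
have pm0 : (0 < p ^ m)%N by rewrite expn_gt0 ltnW.
have [ab /eqP rE] := andP abc; split.
  rewrite /adm; apply/andP; split; first by lia.
  by rewrite -rE; apply/eqP; congr cls; lia.
rewrite /idx addn_eq0 (gtn_eqF pm0) andbF.
case: (posnP a) => [a0|a0] /=; apply/orP; [right; apply/orP; left | left];
  apply/existsP; exists m.
  rewrite (rsub2_admissible abc) a0 !add0n preceq_pow digit_class // b_m.
  by rewrite ominus_pow ?eqxx.
by rewrite preceq_pow digit_class // b_m ominus_pow ?eqxx.
Qed.

Lemma below_xx a b c m : adm a b c -> (c < q)%N -> (0 < c %/ p ^ m %% p)%N ->
  adm (a + 2 * p ^ m) b (c - p ^ m) /\
  below r (idx (a + 2 * p ^ m) b (c - p ^ m)) (idx a b c).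
Proof.
move=> abc c_lt c_m; have c_ge := digit_ge c_m.
have pm0 : (0 < p ^ m)%N by rewrite expn_gt0 ltnW.
have [ab /eqP rE] := andP abc; split.
  rewrite /adm; apply/andP; split; first by lia.
  by rewrite -rE; apply/eqP; congr cls; lia.
rewrite /idx gtn_eqF; last by lia.
case: (posnP a) => [a0|a0] /=.
  apply/orP; left; apply/existsP; exists m.
  rewrite (rsub2_admissible abc) a0 preceq_pow digit_class // c_m.
  by rewrite ominus_pow ?eqxx.
apply/orP; right; apply/orP; left; apply/existsP; exists m.
by rewrite preceq_pow digit_class // c_m ominus_pow ?eqxx.
Qed.

Lemma below_xy a b c m : adm a b c -> (c < q)%N -> (0 < c %/ p ^ m %% p)%N ->
  (0 < a)%N ->
  adm (a + p ^ m) (b + p ^ m) (c - p ^ m) /\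
  below r (idx (a + p ^ m) (b + p ^ m) (c - p ^ m)) (idx a b c).
Proof.
move=> abc c_lt c_m a0; have c_ge := digit_ge c_m.
have pm0 : (0 < p ^ m)%N by rewrite expn_gt0 ltnW.
have [ab /eqP rE] := andP abc; split.
  rewrite /adm; apply/andP; split; first by lia.
  by rewrite -rE; apply/eqP; congr cls; lia.
rewrite /idx !gtn_eqF /=; try by lia.
apply/orP; right; apply/orP; right; apply/orP; left; apply/existsP; exists m.
by rewrite preceq_pow digit_class // c_m ominus_pow ?nt_class_add ?eqxx.
Qed.

(** For [a = 0] this is not a generating relation: one has to exchange [a] and
    [b], apply the relation, and exchange back. *)
Lemma le_r_xy a b c m : adm a b c -> (c < q)%N -> (0 < c %/ p ^ m %% p)%N ->
  adm (a + p ^ m) (b + p ^ m) (c - p ^ m) /\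
  le_r r (idx (a + p ^ m) (b + p ^ m) (c - p ^ m)) (idx a b c).
Proof.
move=> abc c_lt c_m.
have [a0|a0] := posnP a; last first.
  by have [? ?] := below_xy abc c_lt c_m a0; split=> //; apply: connect1.
have b0 : (0 < b)%N by have [] := andP abc; rewrite a0.
have bac : adm b a c by rewrite admissibleC.
have [bac' le'] := below_xy bac c_lt c_m b0.
rewrite admissibleC; split=> //.
rewrite /le_r (connect_trans (connect1 (below_swap bac'))) //.
by rewrite (connect_trans (connect1 le')) // connect1 // below_swap.
Qed.

Variant below_spec a b c : Th -> Prop :=
| BelowSwap : below_spec a b c (idx b a c)
| BelowShift m of (0 < b %/ p ^ m %% p)%N :
    below_spec a b c (idx (a + p ^ m) (b - p ^ m) c)
| BelowXX m of (0 < c %/ p ^ m %% p)%N :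
    below_spec a b c (idx (a + 2 * p ^ m) b (c - p ^ m))
| BelowXY m of (0 < c %/ p ^ m %% p)%N :
    below_spec a b c (idx (a + p ^ m) (b + p ^ m) (c - p ^ m)).

Lemma belowP a b c x : adm a b c -> (b < q)%N -> (c < q)%N ->
  below r x (idx a b c) -> below_spec a b c x.
Proof.
move=> abc b_lt c_lt; have [ab _] := andP abc.
have pm0 m : (0 < p ^ m)%N by rewrite expn_gt0 ltnW.
have idxS a' b' c' : (0 < a')%N -> idx a' b' c' = (Some (cls b'), cls c').
  by move=> a'0; rewrite /idx gtn_eqF.
rewrite {1}/idx; have [a0|a0] := posnP a.
  have b0 : (0 < b)%N by rewrite a0 in ab.
  rewrite a0 /= (rsub2_admissible abc) a0 add0n.
  case/or3P => [/existsP[m]|/existsP[m]|/eqP ->].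
  - rewrite preceq_pow digit_class // => /andP[c_m /eqP ->].
    rewrite ominus_pow //; have := @BelowXX 0%N b c m c_m.
    by rewrite idxS // add0n muln_gt0 pm0.
  - rewrite preceq_pow digit_class // => /andP[b_m /eqP ->].
    rewrite ominus_pow //; have := @BelowShift 0%N b c m b_m.
    by rewrite idxS // add0n pm0.
  have := @BelowSwap 0%N b c; by rewrite idxS.
move=> /= /or4P[/existsP[m]|/existsP[m]|/existsP[m]|].
- rewrite preceq_pow digit_class // => /andP[b_m /eqP ->].
  rewrite ominus_pow //; have := @BelowShift a b c m b_m.
  by rewrite idxS // addn_gt0 a0.
- rewrite preceq_pow digit_class // => /andP[c_m /eqP ->].
  rewrite ominus_pow //; have := @BelowXX a b c m c_m.
  by rewrite idxS // addn_gt0 a0.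
- rewrite preceq_pow digit_class // => /andP[c_m /eqP ->].
  rewrite ominus_pow //; have := @BelowXY a b c m c_m.
  by rewrite idxS ?addn_gt0 ?a0 // nt_class_add.
have := @BelowSwap a b c; rewrite (sub_rsub2_admissible abc) // nt_class_eq0.
case: (posnP b) => [->|b0] /=; first by rewrite /idx eqxx => ? /eqP ->.
by rewrite idxS // orbF => ? /eqP ->.
Qed.

Variant theta_spec : Th -> Prop :=
  ThetaSpec a b c of adm a b c & (b < q)%N & (c < q)%N : theta_spec (idx a b c).

Lemma thetaP x : theta_spec x.
Proof.
have nrepE (a : Nt) : cls (nrep a) = a by rewrite nrepK ?q_gt1.
have sub0 (a b : Nt) : a != 0 -> nt_sub a b != 0 /\ b + nt_sub a b = a.
  move=> a0; have := nt_subP b (nt_sub a b) q_gt1 a0.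
  by rewrite eqxx => /esym/andP[? /eqP].
have nrep0 (a : Nt) : (0 < nrep a)%N = (a != 0).
  by rewrite lt0n -nt_class_eq0 nrepE.
case: x => j0 j1; have [s0 sE] := sub0 r (j1 *+ 2) r_neq0.
rewrite -/(rsub2 r j1) in s0 sE.
case: j0 => [j0|].
  have [a0 aE] := sub0 _ j0 s0.
  have := @ThetaSpec (nrep (nt_sub (rsub2 r j1) j0)) (nrep j0) (nrep j1).
  rewrite /idx !nrepE gtn_eqF ?nrep0 //; apply; rewrite ?nrep_lt // /adm.
  rewrite addn_gt0 nrep0 a0 nt_class_add nt_class_mul2 nt_class_add !nrepE.
  by rewrite [X in X + _]addrC aE addrC sE eqxx.
have := @ThetaSpec 0%N (nrep (rsub2 r j1)) (nrep j1).
rewrite /idx !nrepE; apply; rewrite ?nrep_lt // /adm.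
by rewrite add0n nrep0 s0 nt_class_add nt_class_mul2 !nrepE addrC sE eqxx.
Qed.

End Theta.
End NtildeArithmetic.

(** * Monomials in characteristic p *)

Section CharacteristicP.
Variables (p f : nat) (k : finFieldType).
Hypotheses (p_prime : prime p) (card_k : #|k| = (p ^ f)%N).
Local Notation q := (p ^ f)%N.

Lemma f_gt0 : (0 < f)%N.
Proof.
rewrite lt0n; apply/eqP => f0; have := card_finRing_gt1 k.
by rewrite card_k f0.
Qed.

Lemma Frobenius_powD m (x y : k) : (x + y) ^+ (p ^ m) = x ^+ (p ^ m) + y ^+ (p ^ m).
Proof.
apply: exprDn_pchar; have pk := card_finPcharP card_k p_prime.
by rewrite (eq_pnat _ (pcharf_eq pk)) pnatX pnat_id.
Qed.

Lemma coef_1DXn n i : ((1 + 'X : {poly k}) ^+ n)`_i = 'C(n, i)%:R.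
Proof.
elim: n i => [|n IHn] i; first by rewrite expr0 coef1 bin0n.
rewrite exprS mulrDl mul1r coefD coefXM IHn; case: i => [|i].
  by rewrite addr0 !bin0.
by rewrite IHn binS natrD.
Qed.

(** A case of Lucas' theorem, from [(1 + X)^n = (1 + X^(p^m))^u * (1 + X)^l]
    with [l < p^m]. *)
Lemma bin_pow_digit n m : 'C(n, p ^ m)%:R = (n %/ p ^ m %% p)%:R :> k.
Proof.
have pk := card_finPcharP card_k p_prime.
set P := (p ^ m)%N; have P0 : (0 < P)%N by rewrite expn_gt0 prime_gt0.
rewrite -coef_1DXn {1}(divn_eq n P) exprD mulnC exprM.
set u := (n %/ P)%N; set l := (n %% P)%N.
have -> : (1 + 'X : {poly k}) ^+ P = (1 + 'X) \Po 'X^P.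
  rewrite comp_polyD comp_polyX comp_polyC exprDn_pchar ?expr1n //.
  by rewrite (eq_pnat _ (pchar_poly _)) (eq_pnat _ (pcharf_eq pk)) pnatX pnat_id.
have -> : ((1 + 'X) \Po 'X^P : {poly k}) ^+ u = ((1 + 'X) ^+ u) \Po 'X^P.
  by rewrite rmorphXn.
rewrite coefM (bigD1 ord_max) //= subnn coef_comp_poly_Xn // dvdnn divnn P0.
rewrite !coef_1DXn bin1 bin0 mulr1 big1 ?addr0; last first.
  move=> i i_max; rewrite coef_comp_poly_Xn //; case: ifP => [|_]; last by rewrite mul0r.
  have i_lt : (i < P)%N.
    by rewrite ltn_neqAle -ltnS ltn_ord andbT -(inj_eq val_inj) in i_max *.
  case/dvdnP=> j iE; rewrite !coef_1DXn.
  have -> : (i : nat) = 0%N.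
    by case: j iE => [->//|j iE]; move: i_lt; rewrite iE mulSn ltnNge leq_addr.
  by rewrite subn0 [X in _ * X%:R]bin_small ?mulr0 // ltn_mod.
by rewrite [in LHS](divn_eq u p) natrD natrM (pcharf0 pk) mulr0 add0r.
Qed.

Lemma natr_digit_neq0 n : (0 < n %% p)%N -> (n %% p)%:R != 0 :> k.
Proof.
move=> n_p; rewrite -(dvdn_pcharf (card_finPcharP card_k p_prime)).
by rewrite gtnNdvd // ltn_mod prime_gt0.
Qed.

Section Spans.
Variables (E : fieldType) (iota : {rmorphism k -> E}).

(** A polynomial of degree less than [q] in [lam] with vector coefficients is
    determined by its values at the [q] elements of [k]; inverting the
    Vandermonde matrix recovers each coefficient as a combination of values. *)
Lemma poly_coef_mem (vT : vectType E) (W : {vspace vT}) (v : nat -> vT) :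
    (forall lam : k, \sum_(i < q) iota lam ^+ i *: v i \in W) ->
  forall i, (i < q)%N -> v i \in W.
Proof.
move=> vW i i_lt; pose ev (j : 'I_q) : k := enum_val (cast_ord (esym card_k) j).
have ev_inj : injective ev by move=> j j' /enum_val_inj/cast_ord_inj.
pose M := Vandermonde q (\row_j iota (ev j)).
have M_unit : M \in unitmx.
  rewrite unitmxE det_Vandermonde unitfE.
  apply/prodf_neq0 => j _; apply/prodf_neq0 => j' jj'.
  rewrite !mxE subr_eq0 (inj_eq (fmorph_inj iota)) (inj_eq ev_inj) -(inj_eq val_inj).
  by rewrite gtn_eqF.
suff -> : v i = \sum_j invmx M j (Ordinal i_lt) *: \sum_(l < q) iota (ev j) ^+ l *: v l.
  by apply: memv_suml => j _; rewrite memvZ.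
under eq_bigr => j _ do (rewrite scaler_sumr; under eq_bigr => l _ do rewrite scalerA).
rewrite exchange_big /=; under eq_bigr => l _ do rewrite -scaler_suml.
have E1 (l : 'I_q) :
    \sum_j invmx M j (Ordinal i_lt) * iota (ev j) ^+ l = (l == Ordinal i_lt)%:R.
  have := congr1 (fun N : 'M_q => N l (Ordinal i_lt)) (mulmxV M_unit).
  by rewrite !mxE => <-; apply: eq_bigr => j _; rewrite !mxE mulrC.
under eq_bigr => l _ do rewrite E1.
rewrite (bigD1 (Ordinal i_lt)) //= eqxx scale1r big1 ?addr0 // => l /negPf ->.
by rewrite scale0r.
Qed.

Variable T : finType.

Definition kfun (h : T -> k) : {ffun T -> E^o} := [ffun g => iota (h g)].

Lemma eq_kfun h h' : h =1 h' -> kfun h = kfun h'.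
Proof. by move=> hh'; apply/ffunP => g; rewrite !ffunE hh'. Qed.

Lemma kfunDZ c1 c2 h1 h2 :
  kfun (fun g => c1 * h1 g + c2 * h2 g) = iota c1 *: kfun h1 + iota c2 *: kfun h2.
Proof. by apply/ffunP => g; rewrite !ffunE rmorphD !rmorphM. Qed.

Variables (W : {vspace {ffun T -> E^o}}) (R U Z : T -> k).

(** Writing [U ^ i] as the product over the base [p] digits [d_m] of [i] of
    [(U ^ (p ^ m)) ^ d_m] and using the Frobenius, a substitution
    [U -> c1 * U + c2 * Z] only produces monomials obtained by trading some
    [U ^ (p ^ m)] for [Z ^ (p ^ m)], one digit unit at a time, without
    borrowing. *)
Lemma substitution_mem (P : nat -> nat -> Prop) (c1 c2 : k) :
    (forall i j (m : 'I_f), (i < q)%N -> P i j -> (0 < i %/ p ^ m %% p)%N ->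
       P (i - p ^ m)%N (j + p ^ m)%N) ->
    (forall i j, P i j -> kfun (fun g => R g * U g ^+ i * Z g ^+ j) \in W) ->
  forall i, (i < q)%N -> P i 0%N ->
    kfun (fun g => R g * (c1 * U g + c2 * Z g) ^+ i) \in W.
Proof.
move=> P_step P_mem; have p_gt1 := prime_gt1 p_prime.
pose ev (d : 'I_f -> nat) := (\sum_(m < f) d m * p ^ m)%N.
pose L g := c1 * U g + c2 * Z g.
(* [d1] holds the digits already expanded into powers of [U], [d2] those of
   the remaining power of the linear form; the induction is on the digit sum
   of [d2]. *)
have main n d1 d2 j : (forall m, d1 m + d2 m < p)%N -> \sum_m d2 m = n ->
    P (ev d1 + ev d2)%N j ->
    kfun (fun g => R g * (U g ^+ ev d1 * L g ^+ ev d2) * Z g ^+ j) \in W.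
  elim: n d1 d2 j => [|n IHn] d1 d2 j d12 d2n Pj.
    have d20 : ev d2 = 0%N.
      rewrite /ev big1 // => m _; apply/eqP; rewrite muln_eq0.
      by move/eqP: d2n; rewrite sum_nat_eq0 => /forallP/(_ m) /= ->.
    rewrite d20 addn0 in Pj *.
    by under eq_kfun => g do rewrite expr0 mulr1; apply: P_mem.
  have [m d2m] : exists m, (0 < d2 m)%N.
    apply/existsP; move: d2n; apply: contra_eqT; rewrite negb_exists => /forallP d20.
    by rewrite big1 // => m _; apply/eqP; rewrite eqn0Ngt.
  pose d2' i := (d2 i - (i == m))%N; pose d1' i := (d1 i + (i == m))%N.
  have sum_m (F : 'I_f -> nat) : (\sum_i (i == m) * F i = F m)%N.
    by rewrite (bigD1 m) //= eqxx mul1n big1 ?addn0 // => i /negPf ->.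
  have d2E i : d2 i = (d2' i + (i == m))%N.
    by rewrite /d2'; case: eqP => [->|_]; rewrite ?subnK // subn0 addn0.
  have ev2E : ev d2 = (ev d2' + p ^ m)%N.
    rewrite /ev -(sum_m (fun i => p ^ i)%N) -big_split.
    by apply: eq_bigr => i _; rewrite d2E mulnDl.
  have ev1E : ev d1' = (ev d1 + p ^ m)%N.
    rewrite /ev -(sum_m (fun i => p ^ i)%N) -big_split.
    by apply: eq_bigr => i _; rewrite mulnDl.
  have d2'n : \sum_i d2' i = n.
    apply: succn_inj; rewrite -d2n (eq_bigr _ (fun i _ => d2E i)) big_split -addn1 /=.
    congr (_ + _)%N; rewrite -(sum_m (fun=> 1%N)).
    by apply: eq_bigr => i _; rewrite muln1.
  have d1'2 i : (d1' i + d2' i < p)%N.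
    by rewrite /d1' -addnA [(_ + d2' i)%N]addnC -d2E.
  have d12' i : (d1 i + d2' i < p)%N.
    by apply: leq_ltn_trans (d12 i); rewrite leq_add2l leq_subr.
  have evD : (ev d1 + ev d2)%N = ev (fun i => d1 i + d2 i)%N.
    by rewrite /ev -big_split; apply: eq_bigr => i _; rewrite mulnDl.
  have Pm : P (ev d1 + ev d2')%N (j + p ^ m)%N.
    have -> : (ev d1 + ev d2' = ev d1 + ev d2 - p ^ m)%N by rewrite ev2E addnA addnK.
    apply: P_step => //; rewrite evD; first exact: digits_lt.
    by rewrite digits_mod // addn_gt0 d2m orbT.
  have P1 : P (ev d1' + ev d2')%N j by rewrite ev1E addnAC -addnA -ev2E.
  have := memvD (memvZ (iota (c1 ^+ (p ^ m))) (IHn d1' d2' j d1'2 d2'n P1))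
                (memvZ (iota (c2 ^+ (p ^ m))) (IHn d1 d2' (j + p ^ m)%N d12' d2'n Pm)).
  rewrite -kfunDZ; apply: etrans; congr (_ \in W); apply: eq_kfun => g.
  by rewrite ev2E ev1E !exprD /L Frobenius_powD !exprMn; ring.
move=> i i_lt Pi.
have dsum : ev (fun m => i %/ p ^ m %% p)%N = i by exact: sum_digits.
have ev0 : ev (fun=> 0%N) = 0%N by rewrite /ev big1.
have := @main _ (fun=> 0%N) (fun m => i %/ p ^ m %% p)%N 0%N _ erefl.
rewrite ev0 dsum add0n => H.
rewrite -(eq_kfun (fun g => mulr1 _)); under eq_kfun => g do rewrite -[(_ + _) ^+ _]mul1r.
by apply: H => // m; rewrite ltn_mod ltnW.
Qed.

(** By [bin_pow_digit], the coefficient of [lam ^ (p ^ m)] in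
    [(U + lam * Z) ^ i] is [U ^ (i - p ^ m) * Z ^ (p ^ m)] times the [m]-th digit
    of [i], which is invertible in [k]; and [i < q] lets [poly_coef_mem] apply. *)
Lemma extraction_mem i (m : 'I_f) : (i < q)%N -> (0 < i %/ p ^ m %% p)%N ->
    (forall lam : k, kfun (fun g => R g * (U g + lam * Z g) ^+ i) \in W) ->
  kfun (fun g => R g * U g ^+ (i - p ^ m) * Z g ^+ (p ^ m)) \in W.
Proof.
move=> i_lt i_m iW.
pose v l := kfun (fun g => 'C(i, l)%:R * (R g * U g ^+ (i - l) * Z g ^+ l)).
have vW : v (p ^ m)%N \in W.
  apply: poly_coef_mem => [lam|]; last by rewrite ltn_exp2l ?prime_gt1.
  suff <- : kfun (fun g => R g * (U g + lam * Z g) ^+ i) =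
            \sum_(l < q) iota lam ^+ l *: v l by [].
  apply/ffunP => g; rewrite sum_ffunE !ffunE exprDn mulr_sumr rmorph_sum /=.
  rewrite (big_ord_widen q (fun l => iota (R g * (U g ^+ (i - l) *
             (lam * Z g) ^+ l *+ 'C(i, l))))) // big_mkcond /=.
  apply: eq_bigr => l _; rewrite !ffunE -rmorphXn /= -[RHS]rmorphM.
  case: ifP => [_|/negbT]; first by congr (iota _); rewrite exprMn -mulr_natl; ring.
  by rewrite -leqNgt => /bin_small ->; rewrite mul0r mulr0 rmorph0.
set d := (i %/ p ^ m %% p)%N in i_m *.
have d0 : iota d%:R != 0 by rewrite fmorph_eq0 natr_digit_neq0.
have -> : kfun (fun g => R g * U g ^+ (i - p ^ m) * Z g ^+ (p ^ m)) =
          (iota d%:R)^-1 *: v (p ^ m)%N.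
  apply/ffunP => g; rewrite !ffunE bin_pow_digit -/d [iota (d%:R * _)]rmorphM.
  exact: (esym (mulKf d0 _)).
exact: memvZ.
Qed.
End Spans.
End CharacteristicP.

(** * Dual numbers *)

(** [A] is the ring of dual numbers [k + k * pi], [pi ^ 2 = 0], the embedding
    of [k] being a ring morphism. *)
Record dual_numbers (A : finComUnitRingType) (k : finFieldType)
    (rho : {rmorphism A -> k}) (tau : k -> A) (pi : A) : Prop := DualNumbers {
  tauD : forall x y, tau (x + y) = tau x + tau y;
  tauM : forall x y, tau (x * y) = tau x * tau y;
  rho_tau : forall x, rho (tau x) = x;
  pi2 : pi * pi = 0;
  tau_pi_inj : forall x, tau x * pi = 0 -> x = 0;
  coord_ex : forall l, exists c : k * k, l = tau c.1 + tau c.2 * pi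
}.

Section DualNumberTheory.
Variables (A : finComUnitRingType) (k : finFieldType) (rho : {rmorphism A -> k}).
Variables (tau : k -> A) (pi : A).
Hypothesis dnA : dual_numbers rho tau pi.

Definition eps_coord (l : A) : k := (teich_coord tau pi l).2.
Local Notation hi := eps_coord.

Lemma tau0 : tau 0 = 0.
Proof. by apply: (addrI (tau 0)); rewrite -(tauD dnA) !addr0. Qed.

Lemma tauN x : tau (- x) = - tau x.
Proof. by apply: (addrI (tau x)); rewrite -(tauD dnA) !subrr tau0. Qed.

Lemma rho_pi : rho pi = 0.
Proof.
have /eqP := congr1 rho (pi2 dnA); rewrite rmorphM rmorph0.
by rewrite mulf_eq0 orbb => /eqP.
Qed.

Lemma rho_coord a b : rho (tau a + tau b * pi) = a.
Proof. by rewrite rmorphD rmorphM rho_pi mulr0 addr0 (rho_tau dnA). Qed.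

Lemma teich_coordE a b : teich_coord tau pi (tau a + tau b * pi) = (a, b).
Proof.
rewrite /teich_coord; case: pickP => [[a' b'] /= /eqP eq_ab|/(_ (a, b))]; last first.
  by rewrite eqxx.
have aa' : a = a' by rewrite -(rho_coord a b) eq_ab rho_coord.
rewrite -aa' in eq_ab *; congr (_, _); apply/eqP; rewrite -subr_eq0; apply/eqP.
apply: (tau_pi_inj dnA); rewrite (tauD dnA) tauN mulrBl.
by rewrite -(addrI _ eq_ab) subrr.
Qed.

Lemma eps_coordE a b : hi (tau a + tau b * pi) = b.
Proof. by rewrite /hi teich_coordE. Qed.

Lemma dual_decomp l : l = tau (rho l) + tau (hi l) * pi.
Proof.
by have [[a b] ->] := coord_ex dnA l; rewrite rho_coord eps_coordE.
Qed.

Lemma teich_coord_rho l : teich_coord tau pi l = (rho l, hi l).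
Proof. by rewrite {1}(dual_decomp l) teich_coordE. Qed.

Lemma eps_coordD l l' : hi (l + l') = hi l + hi l'.
Proof.
rewrite {1}(dual_decomp l) {1}(dual_decomp l') addrACA -mulrDl.
by rewrite -!(tauD dnA) eps_coordE.
Qed.

Lemma eps_coordM l l' : hi (l * l') = rho l * hi l' + hi l * rho l'.
Proof.
rewrite {1}(dual_decomp l) {1}(dual_decomp l').
have -> : (tau (rho l) + tau (hi l) * pi) * (tau (rho l') + tau (hi l') * pi) =
    tau (rho l * rho l') + tau (rho l * hi l' + hi l * rho l') * pi.
  rewrite (tauD dnA) !(tauM dnA).
  transitivity (tau (rho l) * tau (rho l') + (tau (rho l) * tau (hi l') +
      tau (hi l) * tau (rho l')) * pi + tau (hi l) * tau (hi l') * (pi * pi)).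
    by ring.
  by rewrite (pi2 dnA) mulr0 addr0.
exact: eps_coordE.
Qed.

Lemma tau1 : tau 1 = 1.
Proof.
have tau11 : tau 1 * tau 1 = tau 1 by rewrite -(tauM dnA) mulr1.
rewrite [RHS](dual_decomp 1) rmorph1.
suff -> : hi 1 = 0 by rewrite tau0 mul0r addr0.
have := eps_coordM 1 1; rewrite !mulr1 rmorph1 mul1r mulr1 => h.
by apply: (addrI (hi 1)); rewrite addr0 -h.
Qed.

Lemma eps_coord_tau x : hi (tau x) = 0.
Proof. by have := eps_coordE x 0; rewrite tau0 mul0r addr0. Qed.

Lemma eps_coord0 : hi 0 = 0. Proof. by rewrite -tau0 eps_coord_tau. Qed.
Lemma eps_coord1 : hi 1 = 0. Proof. by rewrite -tau1 eps_coord_tau. Qed.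

Lemma eps_coordN l : hi (- l) = - hi l.
Proof. by apply: (addrI (hi l)); rewrite -eps_coordD !subrr eps_coord0. Qed.

Lemma eps_coord_tau_pi x : hi (tau x * pi) = x.
Proof. by rewrite -[X in hi X]add0r -tau0 eps_coordE. Qed.

Lemma rho_tau_pi x : rho (tau x * pi) = 0.
Proof. by rewrite rmorphM rho_pi mulr0. Qed.

Lemma unit_rho l : (l \is a GRing.unit) = (rho l != 0).
Proof.
apply/idP/idP => [l_unit|l0].
  by have := rmorph_unit rho l_unit; rewrite unitfE.
apply/unitrP; exists (tau (rho l)^-1 - tau (hi l / rho l ^+ 2) * pi).
suff E : (tau (rho l)^-1 - tau (hi l / rho l ^+ 2) * pi) * l = 1.
  by split; rewrite // mulrC.
rewrite [LHS](dual_decomp _) [RHS](dual_decomp 1) eps_coordM.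
rewrite !(rmorphM, rmorphB, rmorph1) /= eps_coordD eps_coordN.
rewrite eps_coord_tau_pi !eps_coord_tau.
rewrite rho_pi (rho_tau dnA) eps_coord1.
by rewrite mulr0 subr0 mulVf //; congr (_ + tau _ * _); field.
Qed.

End DualNumberTheory.

(** * The quotient of the valuation ring *)

Section ValuationBounds.
Variables (F : fieldType) (v : discrete_valuation F).

Lemma vgeD n x y : vge v n x -> vge v n y -> vge v n (x + y).
Proof.
rewrite /vge; have [->|x0] := eqVneq x 0; first by rewrite add0r.
have [->|y0] := eqVneq y 0; first by rewrite addr0 (negPf x0).
have [//|xy0] := eqVneq (x + y) 0 => /= hx hy.
by apply: le_trans (dvalD v x0 y0 xy0); rewrite le_min hx.
Qed.

Lemma vgeM m n x y : vge v m x -> vge v n y -> vge v (m + n) (x * y).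
Proof.
rewrite /vge; have [->|x0] := eqVneq x 0; first by rewrite mul0r eqxx.
have [->|y0] := eqVneq y 0; first by rewrite mulr0 eqxx.
by move=> /= hx hy; rewrite dvalM // lerD ?orbT.
Qed.

Lemma vge_mul_ideal (x : valring v) :
  ideal_mul (@maxideal F v) (@maxideal F v) x -> vge v 2 (val x).
Proof.
case=> s [s_m ->]; elim: s s_m => [|[a b] s IHs] s_m.
  by rewrite big_nil raddf0 /vge eqxx.
have [am bm] := s_m (a, b) (mem_head _ _).
rewrite big_cons rmorphD; apply: vgeD.
  by rewrite rmorphM; apply: (vgeM am bm).
by apply: IHs => ab ab_s; apply: s_m; rewrite inE ab_s orbT.
Qed.

Variables (varpi : valring v) (varpiP : uniformizer varpi).

Lemma vge_div (n : int) (x : valring v) : 0 <= n -> vge v (n + 1) (val x) ->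
  exists2 y : valring v, x = y * varpi & vge v n (val y).
Proof.
move=> n0 xn; have [w0 w1] := varpiP.
have yn : vge v n (val x / val varpi).
  move: xn; rewrite /vge mulf_eq0 invr_eq0 (negPf w0) orbF.
  have [//|x0] /= := eqVneq (val x) 0 => hx.
  have xE := dvalM v (mulf_neq0 x0 (invr_neq0 w0)) w0.
  by rewrite divfK // w1 in xE; rewrite -(lerD2r 1) -xE.
have y_int : val x / val varpi \in valint v.
  rewrite inE; move: yn; rewrite /vge; case: (_ == 0) => //=.
  exact: le_trans.
exists (@exist F (fun z => z \in valint v) _ y_int : valring v) => //.
by apply: val_inj; rewrite rmorphM /= divfK.
Qed.

Lemma maxideal_varpi : maxideal varpi.
Proof. by have [_ w1] := varpiP; rewrite /maxideal /vge w1 lexx orbT. Qed.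

End ValuationBounds.

Section Teichmuller.
Variables (p f : nat) (Qp : fieldType) (vp : discrete_valuation Qp).
Variables (F : fieldExtType Qp) (v : discrete_valuation F) (e : nat).
Variables (k : finFieldType) (red : {rmorphism valring v -> k}).
Variables (A : finComUnitRingType) (pr : {rmorphism valring v -> A}).
Variables (rho : {rmorphism A -> k}) (t : k -> valring v) (varpi : valring v).
Hypotheses (p_prime : prime p) (QpP : is_Qp p vp).
Hypotheses (eP : ramification_index vp v e) (ramified : (2 <= e)%N).
Hypothesis redP : is_quotient (@maxideal F v) red.
Hypothesis card_k : #|k| = (p ^ f)%N.
Hypothesis prP : is_quotient (ideal_mul (@maxideal F v) (@maxideal F v)) pr.
Hypothesis rhoP : forall x, rho (pr x) = red x.
Hypotheses (tP : is_teichmuller red t) (varpiP : uniformizer varpi).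

Lemma pr_varpi2 : pr varpi * pr varpi = 0.
Proof.
rewrite -rmorphM; apply/(proj2 prP); exists [:: (varpi, varpi)].
split=> [ab|]; last by rewrite big_seq1.
by rewrite inE => /eqP ->; split; apply: maxideal_varpi.
Qed.

Lemma red_eq0 x : red x = 0 -> exists y, x = y * varpi.
Proof.
move/(proj2 redP) => x_m; have [|y -> _] := @vge_div _ _ _ varpiP 0 x (lexx _).
  by rewrite add0r.
by exists y.
Qed.

Lemma pchar_quotient : p \in [pchar A].
Proof.
rewrite inE p_prime /=; apply/eqP; rewrite -(rmorph_nat pr); apply/(proj2 prP).
have [p0 vp1] := Qp_val QpP (prime_gt0 p_prime).
rewrite (logn_prime _ p_prime) eqxx in vp1.
have v_p : vge v (1 + 1) (val (p%:R : valring v)).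
  rewrite rmorph_nat /vge; apply/orP; right.
  have -> : p%:R = (p%:R : Qp)%:A :> F by rewrite scaler_nat.
  by rewrite (proj2 eP) // vp1 mulr1.
have [y -> y1] := vge_div varpiP ler01 v_p.
exists [:: (y, varpi)]; split=> [ab|]; last by rewrite big_seq1.
by rewrite inE => /eqP ->; split=> //; apply: maxideal_varpi.
Qed.

(** In characteristic [p], adding an element of square zero does not change
    the [p]-th power. *)
Lemma expp_rho (a b : A) : rho a = rho b -> a ^+ p = b ^+ p.
Proof.
move=> ab; have [z zE] := proj1 prP (a - b).
have [y yE] : exists y, z = y * varpi.
  by apply: red_eq0; rewrite -rhoP zE rmorphB ab subrr.
have -> : a = b + pr z by rewrite zE addrC subrK.
rewrite exprDn_pchar; last first.
  by rewrite (eq_pnat _ (pcharf_eq pchar_quotient)) pnat_id.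
have -> : p = p.-2.+2 by case: p p_prime => [|[]].
by rewrite yE rmorphM [X in _ + X]exprMn -(addn2 p.-2) [X in _ * X]exprD
  expr2 pr_varpi2 !mulr0 addr0.
Qed.

(** The Teichmueller lift is additive because every element of [k] is a [p]-th
    power and [p = 0] in [A], the extension being ramified. *)
Lemma teichmullerD x y : pr (t (x + y)) = pr (t x) + pr (t y).
Proof.
have [tM redt] := tP.
have root (x' : k) : exists z, x' = z ^+ p.
  exists (x' ^+ (p ^ f.-1)); rewrite -exprM -expnSr prednK ?(f_gt0 card_k) //.
  by rewrite -card_k expf_card.
have tX n z : pr (t (z ^+ n.+1)) = pr (t z) ^+ n.+1.
  by elim: n => // n IHn; rewrite exprS tM rmorphM IHn -exprS.
have tXp z : pr (t (z ^+ p)) = pr (t z) ^+ p by rewrite -(prednK (prime_gt0 p_prime)) tX.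
have [[x1 ->] [y1 ->]] := (root x, root y).
have Dp (R : comNzRingType) (a b : R) : p \in [pchar R] ->
    (a + b) ^+ p = a ^+ p + b ^+ p.
  by move=> pR; rewrite exprDn_pchar // (eq_pnat _ (pcharf_eq pR)) pnat_id.
rewrite -(Dp k) ?(card_finPcharP card_k) // !tXp -Dp ?pchar_quotient //.
by apply: expp_rho; rewrite rmorphD !rhoP !redt.
Qed.

Lemma teichmuller_dual : dual_numbers rho (fun x => pr (t x)) (pr varpi).
Proof.
have [tM redt] := tP; split.
- exact: teichmullerD.
- by move=> x y; rewrite tM rmorphM.
- by move=> x; rewrite rhoP redt.
- exact: pr_varpi2.
- move=> x; rewrite -rmorphM => /(proj2 prP)/vge_mul_ideal; rewrite rmorphM /vge.
  have [w0 w1] := varpiP; rewrite mulf_eq0 (negPf w0) orbF => tx.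
  rewrite -(redt x); apply/(proj2 redP); rewrite /maxideal /vge; move: tx.
  have [//|tx0] /= := eqVneq (val (t x)) 0.
  by rewrite dvalM // w1 -[2]/(1 + 1) lerD2r.
- move=> l; have [x <-] := proj1 prP l.
  have [|y yE] := @red_eq0 (x - t (red x)); first by rewrite rmorphB redt subrr.
  have [|z zE] := @red_eq0 (y - t (red y)); first by rewrite rmorphB redt subrr.
  exists (red x, red y) => /=.
  rewrite -[x in LHS](subrK (t (red x))) yE -[y in LHS](subrK (t (red y))) zE.
  by rewrite !(rmorphD, rmorphM) mulrDl -mulrA pr_varpi2 mulr0 add0r addrC.
Qed.

End Teichmuller.

(** * Generators of GL_2 over a local ring *)

Section Gl2.
Variable A : finComUnitRingType.
Local Notation G := {'GL_2[A]}.

Lemma gl_mxM (g h : G) : gl_mx (g * h)%g = gl_mx g *m gl_mx h.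
Proof. by []. Qed.

Lemma gl_mx_inj : injective (@gl_mx A).
Proof. exact: val_inj. Qed.

Lemma gl_of a b c d : a * d - b * c \is a GRing.unit ->
  exists g : G, gl_mx g = mx2 a b c d.
Proof.
move=> u; have U : mx2 a b c d \is a GRing.unit.
  by rewrite -[_ \is a _]/(_ \in unitmx) unitmxE det_mx2.
by exists (FinRing.unit _ U).
Qed.

Lemma upper_of b : exists g : G, gl_mx g = mx2 1 b 0 1.
Proof. by apply: gl_of; rewrite mulr0 subr0 mulr1 unitr1. Qed.

Lemma det_gl_unit (g : G) : \det (gl_mx g) \is a GRing.unit.
Proof. by rewrite -unitmxE; apply: (valP g). Qed.

Lemma mulmx_2 (M N : 'M[A]_2) i j : (M *m N) i j = M i 0 * N 0 j + M i 1 * N 1 j.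
Proof.
rewrite mxE !big_ord_recl big_ord0 addr0; congr (_ * _ + M i _ * N _ j); exact: val_inj.
Qed.

Lemma mx2_eta (M : 'M[A]_2) : M = mx2 (M 0 0) (M 0 1) (M 1 0) (M 1 1).
Proof.
apply/matrixP => i j; rewrite !mxE.
by case: i => [[|[|//]] i_lt]; case: j => [[|[|//]] j_lt];
  congr (M _ _); apply: val_inj.
Qed.

Lemma mulmx2 (a b c d a' b' c' d' : A) : mx2 a b c d *m mx2 a' b' c' d' =
  mx2 (a * a' + b * c') (a * b' + b * d') (c * a' + d * c') (c * b' + d * d').
Proof. by rewrite [LHS]mx2_eta !mulmx_2 !mxE. Qed.

Lemma lam_mx0 : gl_mx (lam_mx (0 : A)) = mx2 0 1 1 0.
Proof. by []. Qed.

(** Over a local ring, one entry of the first column of an invertible matrix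
    is a unit; up to a multiplication by [w] it is the upper one, and the matrix
    then factors as lower unipotent, diagonal, upper unipotent, the lower
    unipotent factor being conjugate to an upper one by [w]. *)
Lemma gl2_gen (S : G -> Prop) :
    (forall a b : A, a + b \is a GRing.unit ->
       (a \is a GRing.unit) || (b \is a GRing.unit)) ->
    (forall g h, S g -> S h -> S (g * h)%g) -> S (lam_mx 0) ->
    (forall g b, gl_mx g = mx2 1 b 0 1 -> S g) ->
    (forall g u v, u \is a GRing.unit -> v \is a GRing.unit ->
       gl_mx g = mx2 u 0 0 v -> S g) ->
  forall g, S g.
Proof.
move=> local_A SM Sw Supper Sdiag.
have main (g : G) : gl_mx g 0 0 \is a GRing.unit -> S g.
  set a := gl_mx g 0 0 => a_unit; set b := gl_mx g 0 1.
  set c := gl_mx g 1 0; set d := gl_mx g 1 1.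
  have gE : gl_mx g = mx2 a b c d by apply: mx2_eta.
  have d'_unit : d - c * a^-1 * b \is a GRing.unit.
    rewrite -(unitrMr _ a_unit); have := det_gl_unit g; rewrite gE det_mx2.
    by rewrite mulrBr [c / a]mulrC -[a^-1 * c * b]mulrA mulVKr // [c * b]mulrC.
  have [n1 n1E] := upper_of (c * a^-1).
  have [n2 n2E] := upper_of (a^-1 * b).
  have [h hE] : exists h : G, gl_mx h = mx2 a 0 0 (d - c * a^-1 * b).
    by apply: gl_of; rewrite mulr0 subr0 unitrM a_unit.
  have -> : g = (lam_mx 0 * n1 * lam_mx 0 * h * n2)%g.
    apply: gl_mx_inj; rewrite !gl_mxM lam_mx0 n1E n2E hE gE !mulmx2.
    by congr mx2; rewrite ?(mul0r, mulr0, mul1r, mulr1, add0r, addr0) ?mulVKr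
      ?divrK // ?(mulrCA _ a) ?[a * _]mulrC ?divrK // mulrA addrC subrK.
  by apply: (SM _ _ (SM _ _ (SM _ _ (SM _ _ Sw (Supper _ _ n1E)) Sw)
       (Sdiag _ _ _ a_unit d'_unit hE)) (Supper _ _ n2E)).
move=> g; have := det_gl_unit g; rewrite [gl_mx g]mx2_eta det_mx2 => /local_A.
rewrite unitrN !unitrM => /orP[/andP[/main //]|/andP[_ c_unit]].
have -> : g = (lam_mx 0 * (lam_mx 0 * g))%g.
  apply: gl_mx_inj; rewrite !gl_mxM lam_mx0 [gl_mx g]mx2_eta !mulmx2.
  by rewrite !(mul0r, mul1r, add0r, addr0).
apply: (SM _ _ Sw); apply: main.
by rewrite gl_mxM lam_mx0 mulmx_2 !mxE /= mul0r mul1r add0r.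
Qed.

End Gl2.

(** * The action on functions *)

Section Action.
Variables (A : finComUnitRingType) (E : fieldType).
Local Notation G := {'GL_2[A]}.
Local Notation fun_G := {ffun G -> E^o}.

Fact gl_act_linear (g : G) : linear (@gl_act A E g).
Proof. by move=> c phi psi; apply/ffunP => x; rewrite !ffunE. Qed.

HB.instance Definition _ (g : G) :=
  GRing.isLinear.Build E fun_G fun_G *:%R (@gl_act A E g) (gl_act_linear g).

Lemma gl_actM (g h : G) (phi : fun_G) :
  gl_act (g * h)%g phi = gl_act g (gl_act h phi).
Proof. by apply/ffunP => x; rewrite !ffunE mulgA. Qed.

Lemma gl_act1 (phi : fun_G) : gl_act 1%g phi = phi.
Proof. by apply/ffunP => x; rewrite ffunE mulg1. Qed.

Lemma gl_act_span (g : G) (X : seq fun_G) (W : {vspace fun_G}) :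
    {in X, forall phi, gl_act g phi \in W} ->
  forall phi, phi \in <<X>>%VS -> gl_act g phi \in W.
Proof.
move=> XW phi phiX.
have -> : gl_act g phi = linfun (@gl_act A E g) phi by rewrite lfunE.
have : (linfun (@gl_act A E g) @: <<X>> <= W)%VS.
  rewrite limg_span; apply/span_subvP => _ /mapP[psi psiX ->].
  by rewrite lfunE; apply: XW.
by move/subvP; apply; apply: memv_img.
Qed.

Lemma gl_generated_stable (phi : fun_G) : gl_stable (gl_generated phi).
Proof.
move=> g; apply: gl_act_span => _ /mapP[h _ ->].
by rewrite -gl_actM; apply/memv_span/(image_f (fun x => gl_act x phi)).
Qed.

Lemma gl_generated_min (phi : fun_G) (W : {vspace fun_G}) :
  gl_stable W -> phi \in W -> (gl_generated phi <= W)%VS.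
Proof. by move=> W_st phiW; apply/span_subvP => _ /mapP[h _ ->]; apply: W_st. Qed.

Lemma mem_gl_generated (phi : fun_G) : phi \in gl_generated phi.
Proof.
rewrite -[X in X \in _]gl_act1.
exact/memv_span/(image_f (fun x => gl_act x phi)).
Qed.

End Action.

(** * Coordinates of the bottom row *)

Section Monomials.
Variables (p f : nat) (A : finComUnitRingType) (k : finFieldType).
Variables (rho : {rmorphism A -> k}) (tau : k -> A) (pi : A).
Variables (E : fieldType) (iota : {rmorphism k -> E}).
Hypothesis p_prime : prime p.
Hypothesis card_k : #|k| = (p ^ f)%N.
Hypothesis dnA : dual_numbers rho tau pi.
Variables r s : Ntilde p f.
Hypothesis r_neq0 : r != 0.

Local Notation G := {'GL_2[A]}.
Local Notation fun_G := {ffun G -> E^o}.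
Local Notation q := (p ^ f)%N.
Local Notation cls := (nt_class p f).
Local Notation hi := (eps_coord tau pi).
Local Notation adm := (admissible r).
Local Notation idx := (monomial_index p f).
Implicit Types (a b c : nat) (g h : G).

Let p_gt1 : (1 < p)%N := prime_gt1 p_prime.
Let f_gt0 := f_gt0 card_k.

Definition coord_x g : k := rho (gl_mx g 1 0).
Definition coord_y g : k := rho (gl_mx g 1 1).
(** [D / x ^ 2] is the coefficient of [pi] in [d / c], for a bottom row [(c, d)]
    with [c] a unit; but [D] makes sense without this condition. *)
Definition coord_D g : k :=
  coord_x g * hi (gl_mx g 1 1) - coord_y g * hi (gl_mx g 1 0).
Definition det_k g : k := rho (\det (gl_mx g)).

Local Notation X := coord_x.
Local Notation Y := coord_y.
Local Notation D := coord_D.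

(** Natural exponents rather than classes, so that binomial expansions make
    sense; the values only depend on the classes, by [expr_nt_class]. *)
Definition monomial a b c : fun_G :=
  kfun iota (fun g => det_k g ^+ nrep s * (X g ^+ a * Y g ^+ b * D g ^+ c)).

Lemma expr_nt_class (x : k) n : x ^+ nrep (cls n) = x ^+ n.
Proof.
rewrite nrep_class ?q_gt1 //; case: n => // n.
rewrite [in RHS](divn_eq n q.-1); elim: (n %/ q.-1)%N => [//|j IHj].
have -> : ((j.+1 * q.-1 + n %% q.-1).+1 = q + (j * q.-1 + n %% q.-1))%N.
  by have := q_gt1 p_gt1 f_gt0; nia.
by rewrite exprD -card_k expf_card -exprS card_k.
Qed.

Lemma expr_weight (x : k) a b c : adm a b c -> x ^+ nrep r = x ^+ (a + b + 2 * c).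
Proof. by case/andP => _ /eqP <-; rewrite expr_nt_class. Qed.

(** * The action on the coordinates *)

Lemma row1M g h (a b c d : A) : gl_mx h = mx2 a b c d ->
  (gl_mx (g * h)%g 1 0 = gl_mx g 1 0 * a + gl_mx g 1 1 * c) *
  (gl_mx (g * h)%g 1 1 = gl_mx g 1 0 * b + gl_mx g 1 1 * d).
Proof. by move=> hE; rewrite !gl_mxM !mulmx_2 hE !mxE. Qed.

Lemma det_kM g h : det_k (g * h)%g = det_k g * det_k h.
Proof. by rewrite /det_k gl_mxM det_mulmx rmorphM. Qed.

Let hi_simp := (eps_coord_tau_pi dnA, eps_coordD dnA, eps_coordM dnA,
  eps_coordN dnA, eps_coord_tau dnA, eps_coord0 dnA, eps_coord1 dnA,
  rho_tau dnA, rho_tau_pi dnA, rmorphD, rmorphM, rmorph0, rmorph1,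
  mulr0, mul0r, mulr1, mul1r, add0r, addr0).

Lemma coord_w g : (X (g * lam_mx 0)%g = Y g) * (Y (g * lam_mx 0)%g = X g) *
  (D (g * lam_mx 0)%g = - D g).
Proof.
have h := row1M g (lam_mx0 A); rewrite /D /X /Y !h !hi_simp.
move: (gl_mx g 1 0) (gl_mx g 1 1) => x y.
move: (rho x) (rho y) (hi x) (hi y) => x0 y0 x1 y1.
by split=> //; ring.
Qed.

Lemma coord_upper g h lam : gl_mx h = mx2 1 (tau lam) 0 1 ->
  (X (g * h)%g = X g) * (Y (g * h)%g = Y g + lam * X g) * (D (g * h)%g = D g).
Proof.
move=> hE; rewrite /D /X /Y !(row1M g hE) !hi_simp.
move: (gl_mx g 1 0) (gl_mx g 1 1) => x y.
move: (rho x) (rho y) (hi x) (hi y) => x0 y0 x1 y1.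
by split; first split=> //; ring.
Qed.

Lemma coord_upper_eps g h lam : gl_mx h = mx2 1 (tau lam * pi) 0 1 ->
  (X (g * h)%g = X g) * (Y (g * h)%g = Y g) * (D (g * h)%g = D g + lam * X g ^+ 2).
Proof.
move=> hE; rewrite /D /X /Y !(row1M g hE) !hi_simp.
move: (gl_mx g 1 0) (gl_mx g 1 1) => x y.
move: (rho x) (rho y) (hi x) (hi y) => x0 y0 x1 y1.
by split; first split=> //; ring.
Qed.

Lemma coord_diag g h u v : gl_mx h = mx2 u 0 0 v ->
  (X (g * h)%g = rho u * X g) * (Y (g * h)%g = rho v * Y g) *
  (D (g * h)%g = rho u * rho v * D g + (rho u * hi v - rho v * hi u) * (X g * Y g)).
Proof.
move=> hE; rewrite /D /X /Y !(row1M g hE) !hi_simp.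
move: (gl_mx g 1 0) (gl_mx g 1 1) => x y.
move: (rho x) (rho y) (hi x) (hi y) => x0 y0 x1 y1.
by split; first split=> //; ring.
Qed.

Lemma det_k_mx2 h (a b c d : A) : gl_mx h = mx2 a b c d ->
  det_k h = rho a * rho d - rho b * rho c.
Proof. by rewrite /det_k => ->; rewrite det_mx2 rmorphB !rmorphM. Qed.

Lemma gl_act_w a b c :
  gl_act (lam_mx 0) (monomial a b c) = iota ((-1) ^+ (nrep s + c)) *: monomial b a c.
Proof.
apply/ffunP => g; rewrite !ffunE det_kM !coord_w (det_k_mx2 (lam_mx0 A)).
rewrite rmorph0 rmorph1 !mul0r sub0r mulr1 mulrN1.
rewrite -[RHS]rmorphM /=; congr (iota _).
by rewrite exprD [(- det_k g) ^+ nrep s]exprNn [(- D g) ^+ c]exprNn; ring.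
Qed.

Lemma gl_act_upper h lam a b c : gl_mx h = mx2 1 (tau lam) 0 1 ->
  gl_act h (monomial a b c) = kfun iota (fun g =>
    det_k g ^+ nrep s * (X g ^+ a * D g ^+ c) * (Y g + lam * X g) ^+ b).
Proof.
move=> hE; apply/ffunP => g; rewrite !ffunE det_kM (det_k_mx2 hE) !(coord_upper g hE).
rewrite rmorph1 rmorph0 mulr0 subr0 !mulr1.
by congr (iota _); move: (_ ^+ b) => L; ring.
Qed.

Lemma gl_act_upper_eps h lam a b c : gl_mx h = mx2 1 (tau lam * pi) 0 1 ->
  gl_act h (monomial a b c) = kfun iota (fun g =>
    det_k g ^+ nrep s * (X g ^+ a * Y g ^+ b) * (D g + lam * X g ^+ 2) ^+ c).
Proof.
move=> hE; apply/ffunP => g; rewrite !ffunE det_kM (det_k_mx2 hE) !(coord_upper_eps g hE).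
rewrite rmorph1 rmorph0 mulr0 subr0 !mulr1.
by congr (iota _); move: (_ ^+ c) => L; ring.
Qed.

Lemma gl_act_diag h u v a b c : gl_mx h = mx2 u 0 0 v ->
  gl_act h (monomial a b c) =
  iota (det_k h ^+ nrep s * (rho u ^+ a * rho v ^+ b)) *: kfun iota (fun g =>
    det_k g ^+ nrep s * (X g ^+ a * Y g ^+ b) *
    (rho u * rho v * D g + (rho u * hi v - rho v * hi u) * (X g * Y g)) ^+ c).
Proof.
move=> hE; apply/ffunP => g; rewrite !ffunE det_kM !(coord_diag g hE) -[RHS]rmorphM.
by congr (iota _); move: (_ ^+ c) => L; rewrite !exprMn; ring.
Qed.

(** * The basis functions are monomials *)

(** At [g], with bottom row [(c, d)], only the summand of [lam = - d / c]
    contributes, and none does if [c] is not a unit, in which case [x = 0]. *)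
Lemma fbasis_r_affine a b c g : adm a b c -> (0 < a)%N ->
  fbasis_r rho tau pi iota r (Some (cls b), cls c) g =
  iota ((-1) ^+ (b + c) * (X g ^+ a * Y g ^+ b * D g ^+ c)).
Proof.
move=> abc a0; rewrite /fbasis_r sum_ffunE.
have lE l := row1M g (erefl (gl_mx (lam_mx l))).
have XD : X g ^+ nrep r = X g ^+ (a + b + 2 * c) := expr_weight _ abc.
have termE l : tens rho iota r (lam_mx l) (iota (kpow (teich_coord tau pi l).1 (cls b) *
      kpow (teich_coord tau pi l).2 (cls c))) g =
    if gl_mx g 1 0 * l + gl_mx g 1 1 == 0 then
      iota (X g ^+ (a + b + 2 * c) * (rho l ^+ b * hi l ^+ c)) else 0.
  rewrite ffunE inE (teich_coord_rho dnA) /kpow !expr_nt_class.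
  rewrite /chi_ /kpow !lE mulr1 mulr1 mulr0 addr0.
  by rewrite -/(X g) XD /=; case: ifP => // _; rewrite -[LHS]rmorphM.
under eq_bigr => l _ do rewrite termE.
have [X0|X0] := eqVneq (X g) 0.
  rewrite X0 !expr0n !gtn_eqF ?addn_gt0 ?a0 // !mul0r mulr0 big1 => [|l _].
    by rewrite rmorph0.
  by case: ifP => // _; rewrite mul0r rmorph0.
have c_unit : gl_mx g 1 0 \is a GRing.unit by rewrite (unit_rho dnA).
set l0 := - gl_mx g 1 1 / gl_mx g 1 0.
have l0P l : (gl_mx g 1 0 * l + gl_mx g 1 1 == 0) = (l == l0).
  rewrite addr_eq0 /l0 -(inj_eq (mulrI c_unit) l) mulrCA divrr // mulr1.
  by [].
under eq_bigr => l _ do rewrite l0P.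
rewrite -big_mkcond big_pred1_eq; congr (iota _).
have /eqP eq0 : gl_mx g 1 0 * l0 + gl_mx g 1 1 == 0 by rewrite l0P.
have := congr1 rho eq0; rewrite rmorphD rmorphM rmorph0 -/(X g) -/(Y g) => eqr.
have := congr1 hi eq0.
rewrite (eps_coordD dnA) (eps_coordM dnA) (eps_coord0 dnA) -/(X g) => eqh.
have rl : X g * rho l0 = - Y g by apply/eqP; rewrite -addr_eq0 eqr.
have hl : X g ^+ 2 * hi l0 = - D g.
  have -> : X g ^+ 2 * hi l0 = X g * (X g * hi l0 + hi (gl_mx g 1 0) * rho l0 +
     hi (gl_mx g 1 1)) - hi (gl_mx g 1 0) * (X g * rho l0) - X g * hi (gl_mx g 1 1).
    by ring.
  by rewrite eqh rl /D; ring.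
transitivity (X g ^+ a * (X g * rho l0) ^+ b * (X g ^+ 2 * hi l0) ^+ c).
  by rewrite exprD exprM exprD !exprMn; ring.
by rewrite rl hl [(- Y g) ^+ b]exprNn [(- D g) ^+ c]exprNn exprD; ring.
Qed.

Local Notation bas := (fbasis rho tau pi iota s r).

Lemma fbasis_monomial a b c : adm a b c ->
  exists2 z : E, z != 0 & bas (idx a b c) = z *: monomial a b c.
Proof.
move=> abc; have sign_neq0 n : iota ((-1) ^+ n) != 0 by rewrite fmorph_eq0 signr_eq0.
rewrite /monomial_index; have [a0|a0] := posnP a.
  have b0 : (0 < b)%N by have [] := andP abc; rewrite a0.
  have b0c : adm b 0 c by move: abc; rewrite a0 admissibleC.
  exists 1; rewrite ?oner_neq0 // scale1r; apply/ffunP => g; rewrite !ffunE.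
  rewrite (fbasis_r_affine _ b0c b0) !coord_w -[LHS]rmorphM a0 [(- D g) ^+ c]exprNn.
  congr (iota (_ * _)); by rewrite !expr0 add0n mulr1 mul1r mulrCA signrMK.
exists (iota ((-1) ^+ (b + c))) => //; apply/ffunP => g; rewrite !ffunE.
rewrite (fbasis_r_affine _ abc a0) -[LHS]rmorphM -[RHS]rmorphM; congr (iota _).
by rewrite mulrCA.
Qed.

Lemma fbasis_memP a b c (W : {vspace fun_G}) : adm a b c ->
  (bas (idx a b c) \in W) = (monomial a b c \in W).
Proof.
move=> abc; have [z z0 ->] := fbasis_monomial abc.
apply/idP/idP; last exact: memvZ.
by move/(memvZ z^-1); rewrite scalerK.
Qed.

(** * Stability *)

Section Stability.
Variable S : {set Theta p f}.
Hypothesis S_down : forall x y, le_r r x y -> y \in S -> x \in S.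

Let V : {vspace fun_G} := <<[seq bas x | x in S]>>%VS.
Let in_S a b c := adm a b c /\ idx a b c \in S.

Let in_S_mem a b c : in_S a b c -> monomial a b c \in V.
Proof. by case=> abc abcS; rewrite -fbasis_memP // memv_span // image_f. Qed.

Let in_S_swap a b c : in_S a b c -> in_S b a c.
Proof.
case=> abc abcS; split; first by rewrite admissibleC.
by apply: S_down abcS; rewrite /le_r connect1 // below_swap.
Qed.

Let in_S_shift a b c (m : 'I_f) : (b < q)%N -> in_S a b c ->
  (0 < b %/ p ^ m %% p)%N -> in_S (a + p ^ m) (b - p ^ m) c.
Proof.
move=> b_lt [abc abcS] b_m.
have [abc' le'] := below_shift p_gt1 f_gt0 r_neq0 abc b_lt b_m.
by split=> //; apply: S_down abcS; apply: connect1.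
Qed.

Let in_S_xx a b c (m : 'I_f) : (c < q)%N -> in_S a b c ->
  (0 < c %/ p ^ m %% p)%N -> in_S (a + 2 * p ^ m) b (c - p ^ m).
Proof.
move=> c_lt [abc abcS] c_m.
have [abc' le'] := below_xx p_gt1 f_gt0 r_neq0 abc c_lt c_m.
by split=> //; apply: S_down abcS; apply: connect1.
Qed.

Let in_S_xy a b c (m : 'I_f) : (c < q)%N -> in_S a b c ->
  (0 < c %/ p ^ m %% p)%N -> in_S (a + p ^ m) (b + p ^ m) (c - p ^ m).
Proof.
move=> c_lt [abc abcS] c_m.
have [abc' le'] := le_r_xy p_gt1 f_gt0 r_neq0 abc c_lt c_m.
by split=> //; apply: S_down abcS.
Qed.

Lemma stable_of_monomials h :
    (forall a b c, (b < q)%N -> (c < q)%N -> in_S a b c ->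
       gl_act h (monomial a b c) \in V) ->
  forall phi, phi \in V -> gl_act h phi \in V.
Proof.
move=> hV; apply: gl_act_span => _ /imageP[x xS ->].
case: (thetaP p_gt1 f_gt0 r_neq0 x) xS => a b c abc b_lt c_lt abcS.
have [z _ ->] := fbasis_monomial abc.
by rewrite linearZ /= memvZ // hV.
Qed.

Lemma upper_stable h lam phi : gl_mx h = mx2 1 (tau lam) 0 1 ->
  phi \in V -> gl_act h phi \in V.
Proof.
move=> hE; apply: stable_of_monomials => a b c b_lt c_lt abcS.
rewrite (gl_act_upper _ _ _ hE).
under eq_kfun => g do rewrite -[Y g]mul1r.
apply: (substitution_mem p_prime card_k (Z := X)
  (P := fun i j => in_S (a + j) i c) _ _ _ _ b_lt); last by rewrite addn0.
  by move=> i j m i_lt Pij i_m; rewrite addnA; apply: in_S_shift.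
move=> i j Pij; have := in_S_mem Pij; congr (_ \in V); apply: eq_kfun => x.
by rewrite exprD; ring.
Qed.

Lemma upper_eps_stable h lam phi : gl_mx h = mx2 1 (tau lam * pi) 0 1 ->
  phi \in V -> gl_act h phi \in V.
Proof.
move=> hE; apply: stable_of_monomials => a b c b_lt c_lt abcS.
rewrite (gl_act_upper_eps _ _ _ hE).
under eq_kfun => g do rewrite -[D g]mul1r.
apply: (substitution_mem p_prime card_k (Z := fun g => X g ^+ 2)
  (P := fun i j => in_S (a + 2 * j) b i) _ _ _ _ c_lt); last by rewrite muln0 addn0.
  by move=> i j m i_lt Pij i_m; rewrite mulnDr addnA; apply: in_S_xx.
move=> i j Pij; have := in_S_mem Pij; congr (_ \in V); apply: eq_kfun => x.
by rewrite exprD exprM; ring.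
Qed.

Lemma diag_stable h u v phi : gl_mx h = mx2 u 0 0 v ->
  phi \in V -> gl_act h phi \in V.
Proof.
move=> hE; apply: stable_of_monomials => a b c b_lt c_lt abcS.
rewrite (gl_act_diag _ _ _ hE); apply: memvZ.
apply: (substitution_mem p_prime card_k (Z := fun g => X g * Y g)
  (P := fun i j => in_S (a + j) (b + j) i) _ _ _ _ c_lt); last by rewrite !addn0.
  by move=> i j m i_lt Pij i_m; rewrite !addnA; apply: in_S_xy.
move=> i j Pij; have := in_S_mem Pij; congr (_ \in V); apply: eq_kfun => x.
by rewrite !exprD exprMn; ring.
Qed.

Lemma stable_span : gl_stable V.
Proof.
apply: gl2_gen.
- move=> a b; rewrite !(unit_rho dnA) rmorphD; apply: contraNT.
  by rewrite negb_or !negbK => /andP[/eqP -> /eqP ->]; rewrite addr0.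
- by move=> g h gV hV phi phiV; rewrite gl_actM gV ?hV.
- apply: stable_of_monomials => a b c _ _ abcS.
  by rewrite gl_act_w; apply/memvZ/in_S_mem/in_S_swap.
- move=> g l gE phi phiV.
  (* the two coordinates of [l] act one after the other *)
  have [g1 g1E] := upper_of (tau (rho l)).
  have [g2 g2E] := upper_of (tau (hi l) * pi).
  have -> : g = (g1 * g2)%g.
    apply: gl_mx_inj; rewrite gl_mxM gE g1E g2E mulmx2.
    rewrite !(mulr0, mul0r, mulr1, mul1r, add0r, addr0).
    by rewrite [X in mx2 1 X](dual_decomp dnA) addrC.
  by rewrite gl_actM (upper_stable g1E) // (upper_eps_stable g2E).
by move=> g u v _ _ gE phi; apply: diag_stable gE.
Qed.

End Stability.

(** * Generation *)

(** The exchange comes from [w], and each other relation from a one-parameter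
    family of group elements: the unipotents over [k] for [y -> x], the unipotents with entry in [k * pi] for
    [D -> x ^ 2], the matrices [diag(1, 1 + lam * pi)] for [D -> x * y]. *)
Lemma below_mem (W : {vspace fun_G}) x y :
  gl_stable W -> below r x y -> bas y \in W -> bas x \in W.
Proof.
move=> W_st; case: (thetaP p_gt1 f_gt0 r_neq0 y) => a b c abc b_lt c_lt xy.
rewrite fbasis_memP // => abcW.
case: (belowP p_gt1 f_gt0 r_neq0 abc b_lt c_lt xy) => [|m b_m|m c_m|m c_m].
- have bac : adm b a c by rewrite admissibleC.
  rewrite fbasis_memP //; have := W_st (lam_mx 0) _ abcW; rewrite gl_act_w.
  move/(memvZ (iota ((-1) ^+ (nrep s + c)))^-1).
  by rewrite scalerK // fmorph_eq0 signr_eq0.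
- have [abc' _] := below_shift p_gt1 f_gt0 r_neq0 abc b_lt b_m.
  rewrite fbasis_memP //.
  suff /(extraction_mem p_prime card_k b_lt b_m) : forall lam, kfun iota (fun g =>
      det_k g ^+ nrep s * (X g ^+ a * D g ^+ c) * (Y g + lam * X g) ^+ b) \in W.
    by congr (_ \in W); apply: eq_kfun => g; rewrite exprD; ring.
  move=> lam; have [h hE] := upper_of (tau lam).
  by rewrite -(gl_act_upper _ _ _ hE) W_st.
- have [abc' _] := below_xx p_gt1 f_gt0 r_neq0 abc c_lt c_m.
  rewrite fbasis_memP //.
  suff /(extraction_mem p_prime card_k c_lt c_m) : forall lam, kfun iota (fun g =>
      det_k g ^+ nrep s * (X g ^+ a * Y g ^+ b) * (D g + lam * X g ^+ 2) ^+ c) \in W.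
    by congr (_ \in W); apply: eq_kfun => g; rewrite exprD exprM; ring.
  move=> lam; have [h hE] := upper_of (tau lam * pi).
  by rewrite -(gl_act_upper_eps _ _ _ hE) W_st.
have [abc' _] := le_r_xy p_gt1 f_gt0 r_neq0 abc c_lt c_m.
rewrite fbasis_memP //.
suff /(extraction_mem p_prime card_k c_lt c_m) : forall lam, kfun iota (fun g =>
    det_k g ^+ nrep s * (X g ^+ a * Y g ^+ b) * (D g + lam * (X g * Y g)) ^+ c) \in W.
  by congr (_ \in W); apply: eq_kfun => g; rewrite !exprD exprMn; ring.
move=> lam; pose v := 1 + tau lam * pi.
have rv : rho v = 1 by rewrite rmorphD (rho_tau_pi dnA) rmorph1 addr0.
have hv : hi v = lam.
  by rewrite (eps_coordD dnA) (eps_coord1 dnA) (eps_coord_tau_pi dnA) add0r.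
have [h hE] : exists h : G, gl_mx h = mx2 1 0 0 v.
  by apply: gl_of; rewrite mulr0 subr0 mul1r (unit_rho dnA) rv oner_neq0.
have := W_st h _ abcW; rewrite (gl_act_diag _ _ _ hE) (det_k_mx2 hE) rv hv !rmorph1.
rewrite (eps_coord1 dnA) rmorph0 !(mulr0, subr0, mulr1, expr1n) rmorph1 scale1r.
by under eq_kfun => g do rewrite !mul1r.
Qed.

Lemma le_r_mem (W : {vspace fun_G}) x y :
  gl_stable W -> le_r r x y -> bas y \in W -> bas x \in W.
Proof.
move=> W_st /connectP[l]; elim: l x => [|z l IHl] x /=; first by move=> _ ->.
by case/andP=> xz z_l yE /(IHl _ z_l yE); apply: below_mem.
Qed.

(** * Equivariance *)

Lemma coord_borel u g : u \in borel A -> let d := rho (gl_mx u 1 1) in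
  (X (u * g)%g = d * X g) * (Y (u * g)%g = d * Y g) *
  (D (u * g)%g = d ^+ 2 * D g).
Proof.
rewrite inE => /eqP u0 /=.
have rowE j : gl_mx (u * g)%g 1 j = gl_mx u 1 1 * gl_mx g 1 j.
  by rewrite gl_mxM mulmx_2 u0 mul0r add0r.
rewrite /D /X /Y !rowE !(eps_coordM dnA) !rmorphM.
move: (gl_mx u 1 1) (gl_mx g 1 0) (gl_mx g 1 1) => w x y.
move: (rho w) (hi w) (rho x) (rho y) (hi x) (hi y) => w0 w1 x0 y0 x1 y1.
by split; first split=> //; ring.
Qed.

Lemma monomial_borel a b c u g : adm a b c -> u \in borel A ->
  monomial a b c (u * g)%g =
  detpow rho iota s u * chi_ rho iota r u * monomial a b c g.
Proof.
move=> abc uB; rewrite !ffunE det_kM !(coord_borel g uB).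
rewrite /detpow /chi_ /kpow -/(det_k u) (expr_weight _ abc).
rewrite -[X in _ = X * _]rmorphM -[RHS]rmorphM; congr (iota _).
by rewrite exprD exprM exprD !exprMn; ring.
Qed.

Lemma span_induced (chi : G -> E) :
    {in borel A, forall u, chi u = detpow rho iota s u * chi_ rho iota r u} ->
  forall (S : {set Theta p f}) phi,
    phi \in <<[seq bas x | x in S]>>%VS -> phi \in induced chi.
Proof.
move=> chiE S phi; set l := [seq _ | _ in _].
rewrite -[l]/(tval (in_tuple l)) => /coord_span ->.
apply/forall_inP => u uB; apply/forallP => g; rewrite !sum_ffunE mulr_sumr.
apply/eqP/eq_bigr => i _; rewrite !ffunE.
have /imageP[x _ ->] := mem_nth 0 (ltn_ord i).
case: (thetaP p_gt1 f_gt0 r_neq0 x) => a b c abc _ _.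
have [z _ ->] := fbasis_monomial abc; rewrite !ffunE.
have := monomial_borel g abc uB; rewrite -(chiE u uB) !ffunE => ->.
have scaleCA (c1 c2 c3 m : E) : c1 * (c2 * (c3 * m)) = c3 * (c1 * (c2 * m)) by ring.
exact: scaleCA.
Qed.

End Monomials.

(** * Types *)

Section Types.
Variables (p f : nat) (r : Ntilde p f).

Lemma le_type_of (x y : Theta p f) :
  le_type r (type_of r x) (type_of r y) = le_r r x y.
Proof.
apply/exists_inP/idP => [[x' x'P /exists_inP[y' y'P x'y']]|xy].
  move: x'P y'P; rewrite !inE => /andP[xx' _] /andP[_ y'y].
  exact: connect_trans xx' (connect_trans x'y' y'y).
exists x; first by rewrite inE /le_r connect0.
by apply/exists_inP; exists y => //; rewrite inE /le_r connect0.
Qed.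

End Types.
Theorem theorem1p2
  (p : nat) (p_prime : prime p) (p_odd : odd p)
  (* F / Q_p finite, ramified, with normalised valuation v *)
  (Qp : fieldType) (vp : discrete_valuation Qp) (QpP : is_Qp p vp)
  (F : fieldExtType Qp) (v : discrete_valuation F)
  (e : nat) (eP : ramification_index vp v e) (ramified : (2 <= e)%N)
  (* residue field *)
  (k : finFieldType) (red : {rmorphism valring v -> k})
  (redP : is_quotient (@maxideal F v) red)
  (f : nat) (card_k : #|k| = (p ^ f)%N)
  (* A = O / m^2 and its reduction to k *)
  (A : finComUnitRingType) (pr : {rmorphism valring v -> A})
  (prP : is_quotient (ideal_mul (@maxideal F v) (@maxideal F v)) pr)
  (rho : {rmorphism A -> k}) (rhoP : forall x, rho (pr x) = red x)
  (* Teichmueller lift and uniformizer *)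
  (t : k -> valring v) (tP : is_teichmuller red t)
  (varpi : valring v) (varpiP : uniformizer varpi)
  (* coefficient field *)
  (E : fieldType) (iota : {rmorphism k -> E})
  (* the character chi = det^s chi_r of B(A) *)
  (chi : {'GL_2[A]} -> E) (chi_char : is_character chi)
  (s r : Ntilde p f) (s_neq0 : s != 0) (r_neq0 : r != 0)
  (chiE : {in borel A, forall b,
             chi b = detpow rho iota s b * chi_ rho iota r b})
  (* a type and its code *)
  (T : {set Theta p f}) (T_type : is_type r T)
  (I : {set 'I_f}) (gamma : Ntilde p f) (T_code : encodes r I gamma T) :
  let bas := fbasis rho (fun x => pr (t x)) (pr varpi) iota s r in
  let V := Vtype rho (fun x => pr (t x)) (pr varpi) iota s r T in
  {subset V <= induced chi} /\ gl_stable V /\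
  (forall x : Theta p f, type_of r x = T -> V = gl_generated (bas x)).
Proof.
have dnA := teichmuller_dual p_prime QpP eP ramified redP card_k prP rhoP tP varpiP.
move=> bas V; have [x0 TE] := T_type.
have VE : V = <<[seq bas x | x in [set x | le_r r x x0]]>>%VS.
  by rewrite /V /Vtype TE; under eq_finset => x do rewrite le_type_of.
have V_stable : gl_stable V.
  rewrite VE; apply: (stable_span p_prime card_k dnA r_neq0) => x y xy.
  by rewrite !inE => yx0; apply: connect_trans xy yx0.
split; [|split=> // x xT].
  by move=> phi; rewrite VE; apply: (span_induced p_prime card_k dnA r_neq0 chiE).
have : x0 \in type_of r x by rewrite xT TE inE /le_r connect0.
rewrite inE => /andP[xx0 x0x].
apply/eqP; rewrite eqEsubv; apply/andP; split.
  rewrite VE; apply/span_subvP => _ /imageP[y yx0 ->].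
  have yx : le_r r y x by rewrite inE in yx0; apply: connect_trans yx0 x0x.
  apply: (le_r_mem p_prime card_k dnA r_neq0 _ yx); first exact: gl_generated_stable.
  exact: mem_gl_generated.
apply: gl_generated_min => //.
by rewrite VE memv_span // image_f // inE.
Qed.
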